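(* Let $r,s$ be positive integers. The algebra $\Lambda_{r,s,a}$ is Cohen--Macaulay for all but finitely many values of $a\in\mathbb{C}$.
   Context: For $a\in\mathbb{C}$, $\Lambda_{r,s,a}$ denotes the subalgebra of $\mathbb{C}[y_1,\dots,y_r,z_1,\dots,z_s]$ generated by the deformed Newton sums $Q_{r,s,i}=a(y_1^i+\cdots+y_r^i)+(z_1^i+\cdots+z_s^i)$, $i=1,2,\dots$ *)

(* Defs.v *)
From mathcomp Require Import all_boot all_algebra.
From mathcomp Require Import Rstruct.
From mathcomp Require Import complex.
From mathcomp Require Import mpoly.
Set Implicit Arguments.
Unset Strict Implicit.
Unset Printing Implicit Defensive.
Import GRing.Theory.
Local Open Scope ring_scope.

Definition Cplx : fieldType := complex Rdefinitions.R.

(* Deformed Newton sum Q_{r,s,i} in C[y_1..y_r, z_1..z_s]; the variables are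
   'X_(lshift s k) = y_{k+1} and 'X_(rshift r k) = z_{k+1}. *)
Definition Qrs (r s : nat) (a : Cplx) (i : nat) : {mpoly Cplx[r + s]} :=
  a *: (\sum_(k < r) 'X_(lshift s k) ^+ i) + \sum_(k < s) 'X_(rshift r k) ^+ i.

(* Lambda_{r,s,a}: the subalgebra generated by Q_{r,s,i}, i = 1, 2, ...
   (every element is a polynomial in finitely many, hence in Q_1..Q_m for some m). *)
Definition Lambda (r s : nat) (a : Cplx) (p : {mpoly Cplx[r + s]}) : Prop :=
  exists (m : nat) (P : {mpoly Cplx[m]}),
    p = P \mPo [tuple Qrs r s a i.+1 | i < m].

Definition in_ideal {F : fieldType} {n : nat} (A : {mpoly F[n]} -> Prop)
    (th : seq {mpoly F[n]}) (f : {mpoly F[n]}) : Prop :=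
  exists g : seq {mpoly F[n]},
    [/\ size g = size th, (forall x, x \in g -> A x)
      & f = \sum_(i < size th) g`_i * th`_i].

(* Cohen--Macaulay property of a graded subalgebra A of F[x_1..x_n]
   (standard grading): there is a homogeneous system of parameters
   th = (th_1..th_d) (homogeneous of positive degree, with A a finitely
   generated module over F[th_1..th_d]) which is an A-regular sequence,
   i.e. depth A_+ = dim A. *)
Definition CohenMacaulay {F : fieldType} {n : nat} (A : {mpoly F[n]} -> Prop) : Prop :=
  exists th eta : seq {mpoly F[n]},
  [/\ (forall t, t \in th -> A t /\ exists d : nat, (0 < d)%N /\ t \is d.-homog),
      (forall e, e \in eta -> A e),
      (forall f, A f -> exists c : seq {mpoly F[n]},
          [/\ size c = size eta,
              (forall x, x \in c ->
                  exists P : {mpoly F[size th]}, x = P \mPo in_tuple th)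
            & f = \sum_(j < size eta) c`_j * eta`_j])
    & (forall (i : nat) (f : {mpoly F[n]}), (i < size th)%N -> A f ->
          in_ideal A (take i th) (f * th`_i) -> in_ideal A (take i th) f)].
Arguments Qrs r s a i : clear implicits.
Arguments Lambda r s a p : clear implicits.

(* Main.v *)
From HB Require Import structures.
Require Import Defs.
From mathcomp Require Import all_boot all_order all_fingroup all_algebra.
From mathcomp Require Import Rstruct complex mpoly.
From mathcomp Require Import zify ring.
Set Implicit Arguments. Unset Strict Implicit. Unset Printing Implicit Defensive.
Import GRing.Theory.
Local Open Scope ring_scope.

(* The paper's Lambda_{r,s,a} is newton_alg a.  Each f in it is symmetric in the y's and in the z's
   and satisfies (d/dy_i - a d/dz_j) f = 0 on y_i = z_j; let QI_a be the algebra of all such f, and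
   Sym that of all polynomials symmetric in the y's and in the z's.  As a tends to 0, suitable
   elements of Lambda_a divided by a have limits that fill QI_0: there d f/dy_i is divisible by
   prod_j (y_i - z_j), so modulo z one finds the symmetric polynomials in y whose exponents avoid
   1..s, that is Sym^r(C + u^(s+1) C[u]), and this algebra is generated by the power sums p_c(y),
   c > s.  Up to a relabelling of monomials it is the ring of symmetric polynomials in y, as a module
   over the symmetric polynomials in the y_i^(s+1), hence free of rank (s+1)^r.  So there are r+s
   families theta_i and (s+1)^r families eta_B in Lambda_a such that the theta^e eta_B form a basis
   of QI_0.

   In each fixed degree, by semicontinuity of ranks, they remain a basis of QI_a for all but finitely
   many a, and finitely many degrees suffice.  Spanning of Lambda_a: Sym is a finite C[theta]-module
   and by Cayley-Hamilton all variables are roots of one monic polynomial over C[theta], whose degree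
   does not depend on a; it is a recurrence that expresses all Newton sums by the first ones.
   Independence: with delta = prod (y_i - z_j), the ideal delta^2 Sym is contained in QI_a, and Sym
   is free over C[theta] with exactly as many generators as there are eta_B.  Hence Lambda_a is a
   finite free module over the polynomial ring C[theta]. *)

(** * Linear algebra with a parameter *)

Definition lin_indep (F : fieldType) (V : lmodType F) (J : finType) (v : J -> V) :=
  forall c : J -> F, \sum_j c j *: v j = 0 -> forall j, c j = 0.

Lemma sum_mulmx_enum (F : fieldType) (J K : finType) (V : lmodType F)
    (u : 'rV[F]_#|J|) (X : 'M[F]_(#|J|, #|K|)) (w : K -> V) :
  \sum_(j : J) u 0 (enum_rank j) *: (\sum_(k : K) X (enum_rank j) (enum_rank k) *: w k)
  = \sum_(k : K) (u *m X) 0 (enum_rank k) *: w k.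
Proof.
under eq_bigr do rewrite scaler_sumr.
rewrite exchange_big; apply: eq_bigr => k _; rewrite mxE scaler_suml.
rewrite (reindex (@enum_rank J)) /=; last by exists enum_val => ? _; rewrite ?enum_rankK ?enum_valK.
by apply: eq_bigr => j _; rewrite scalerA.
Qed.

(** The matrix expressing [v] through [w] is square, and a row vector killed by it would be a
    relation among the [v j]. So it is invertible and carries every relation among the [w j] back to
    one among the [v j]. *)
Lemma lin_indep_span (F : fieldType) (V : lmodType F) (J : finType) (v w : J -> V) :
  lin_indep v -> (forall j, exists c : J -> F, v j = \sum_k c k *: w k) ->
  lin_indep w.
Proof.
move=> iv /fin_all_exists[c vE] d dw j.
pose X : 'M[F]_#|J| := \matrix_(i, l) c (enum_val i) (enum_val l).
have XE i l : X (enum_rank i) (enum_rank l) = c i l by rewrite mxE !enum_rankK.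
have Xu : X \in unitmx.
  rewrite unitmxE unitfE; apply/det0P => -[u u0 uX]; case/negP: u0; apply/eqP.
  apply/rowP => i; rewrite mxE -(enum_valK i).
  apply: (iv (fun j => u 0 (enum_rank j))).
  under eq_bigr do rewrite vE; under eq_bigr do under eq_bigr do rewrite -XE.
  by rewrite sum_mulmx_enum uX big1 // => l _; rewrite mxE scale0r.
pose u := (\row_i d (enum_val i)) *m invmx X.
have uXE : u *m X = \row_i d (enum_val i) by rewrite mulmxKV.
have u0 i : u 0 (enum_rank i) = 0.
  apply: (iv (fun j => u 0 (enum_rank j))).
  under eq_bigr do rewrite vE; under eq_bigr do under eq_bigr do rewrite -XE.
  rewrite sum_mulmx_enum uXE -[RHS]dw; apply: eq_bigr => l _.
  by rewrite mxE enum_rankK.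
have -> : d j = (u *m X) 0 (enum_rank j) by rewrite uXE mxE enum_rankK.
by rewrite mxE big1 // => i _; rewrite -(enum_valK i) u0 mul0r.
Qed.

(** A right inverse at [a0], kept constant as [C], makes the determinant of [M *m C] equal to 1 at
    [a0]; wherever this determinant does not vanish, [M] has full row rank. *)
Lemma generic_row_free (F : fieldType) (m n : nat) (M : 'M[{poly F}]_(m, n)) (a0 : F) :
  row_free (map_mx (horner_eval a0) M) ->
  exists2 b : {poly F}, b.[a0] != 0 &
    forall a, b.[a] != 0 -> row_free (map_mx (horner_eval a) M).
Proof.
move=> fM; pose C := map_mx polyC (pinvmx (map_mx (horner_eval a0) M)).
have CE a : map_mx (horner_eval a) C = pinvmx (map_mx (horner_eval a0) M).
  by apply/matrixP => i j; rewrite !mxE /horner_eval hornerC.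
have bE a : (\det (M *m C)).[a] = \det (map_mx (horner_eval a) M *m pinvmx (map_mx (horner_eval
  a0) M)).
  by rewrite -(CE a) -map_mxM -[LHS]/(horner_eval a _) -det_map_mx.
exists (\det (M *m C)) => [|a]; first by rewrite bE mulmxVp // det1 oner_neq0.
rewrite bE => d0; set A := map_mx _ _; rewrite /row_free eqn_leq rank_leq_row /=.
have /mxrank_unit rk : A *m pinvmx (map_mx (horner_eval a0) M) \in unitmx.
  by rewrite unitmxE unitfE.
by rewrite -{1}rk mxrankM_maxl.
Qed.

(** Semicontinuity of rank. At a = 0 the coefficients at the marked monomials [M j] determine a
    solution, so there are at most as many independent solutions as there are [v j]. This
    injectivity and the independence of the [v j] are both rank conditions, hence persist away from
    the zeros of [b]. *)
Lemma generic_span (F : fieldType) (n D : nat) (I J : finType)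
    (l0 l1 : I -> {mpoly F[n]} -> {mpoly F[n]})
    (v : J -> {poly {mpoly F[n]}}) (M : J -> 'X_{1..n}) :
  (forall c, linear (l0 c)) -> (forall c, linear (l1 c)) ->
  (forall j i, msize (v j)`_i <= D.+1)%N ->
  (forall a c j, l0 c (v j).[a%:MP] + a *: l1 c (v j).[a%:MP] = 0) ->
  lin_indep (fun j => (v j).[0]) ->
  (forall f, (msize f <= D.+1)%N -> (forall c, l0 c f = 0) ->
     (forall j, f@_(M j) = 0) -> f = 0) ->
  exists2 b : {poly F}, b.[0] != 0 &
    forall a, b.[a] != 0 -> forall f, (msize f <= D.+1)%N ->
      (forall c, l0 c f + a *: l1 c f = 0) ->
      exists c : J -> F, f = \sum_j c j *: (v j).[a%:MP].
Proof.
move=> lin0 lin1 vD vl iv inj0.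
have linS (l : {mpoly F[n]} -> {mpoly F[n]}) : linear l ->
    forall (K : finType) (c : K -> F) (w : K -> {mpoly F[n]}),
    l (\sum_k c k *: w k) = \sum_k c k *: l (w k).
  move=> ll K c w.
  pose L : {linear _ -> _} := HB.pack l (GRing.isLinear.Build F _ _ _ l ll).
  by rewrite -[LHS]/(L _) linear_sum; apply: eq_bigr => k _; rewrite linearZ.
have linB (l : {mpoly F[n]} -> {mpoly F[n]}) : linear l -> {morph l : f g / f - g}.
  move=> ll f g.
  pose L : {linear _ -> _} := HB.pack l (GRing.isLinear.Build F _ _ _ l ll).
  exact: (linearB L).
have mszsum (K : finType) (c : K -> F) (w : K -> {mpoly F[n]}) :
    (forall k, msize (w k) <= D.+1)%N -> (msize (\sum_k c k *: w k) <= D.+1)%N.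
  move=> wD; apply: (leq_trans (msize_sum _ _ _)); apply/bigmax_leqP_seq => k _ _.
  exact: leq_trans (msizeZ_le _ _) (wD k).
have vaD a j : (msize (v j).[a%:MP] <= D.+1)%N.
  rewrite horner_coef; apply: (leq_trans (msize_sum _ _ _)); apply/bigmax_leqP_seq => k _ _.
  by rewrite mulrC -rmorphXn mul_mpolyC (leq_trans (msizeZ_le _ _)).
pose X := 'X_{1..n < D.+1}.
(* [D'] bounds the degrees of the images under [l0], so that at a = 0 finitely many coefficients
   decide whether [l0 c f] vanishes. *)
pose D' := (\max_(c : I) \max_(m : X) msize (l0 c 'X_[m]))%N.
pose T := ((I * 'X_{1..n < D'}) + J)%type.
have fE (f : {mpoly F[n]}) : (msize f <= D.+1)%N -> f = \sum_(m : X) f@_m *: 'X_[m].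
  exact: mpolywE.
(* One column for each coefficient of a condition and one for each marked monomial: row freeness at
   a implies that a solution with vanishing marked coefficients is zero. *)
pose K : 'M[{poly F}]_(#|{: X}|, #|{: T}|) := \matrix_(i < #|{: X}|, t < #|{: T}|)
  match enum_val t : T with
  | inl (c, q) => ((l0 c 'X_[(enum_val i : X)])@_q)%:P + (l1 c 'X_[(enum_val i : X)])@_q *: 'X
  | inr j => (((enum_val i : X) : 'X_{1..n}) == M j)%:R%:P
  end.
pose vec (f : {mpoly F[n]}) : 'rV[F]_#|{: X}| := \row_(i < #|{: X}|) f@_(enum_val i : X).
have vK a f t : (msize f <= D.+1)%N ->
    (vec f *m map_mx (horner_eval a) K) 0 (enum_rank t) =
    match t with inl (c, q) => (l0 c f + a *: l1 c f)@_q | inr j => f@_(M j) end.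
  move=> fD; rewrite mxE (reindex (@enum_rank X)) /=; last first.
    by exists enum_val => ? _; rewrite ?enum_rankK ?enum_valK.
  case: t => [[c q]|j]; last first.
    rewrite {2}(fE f fD) raddf_sum /=; apply: eq_bigr => m _.
    rewrite !mxE !enum_rankK /horner_eval hornerC mcoeffZ mcoeffX.
    by rewrite [in LHS]eq_sym eq_sym.
  have -> : l0 c f + a *: l1 c f = \sum_(m : X) f@_m *: (l0 c 'X_[m] + a *: l1 c 'X_[m]).
    rewrite [in LHS](fE f fD) (linS _ (lin0 c)) (linS _ (lin1 c)) scaler_sumr -big_split /=;
      apply: eq_bigr => m _.
    by rewrite scalerDr !scalerA [a * _]mulrC.
  rewrite raddf_sum /=; apply: eq_bigr => m _.
  rewrite !mxE !enum_rankK /horner_eval hornerD hornerZ hornerX hornerC.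
  by rewrite mcoeffZ mcoeffD mcoeffZ [a * _]mulrC.
have vec_inj f : (msize f <= D.+1)%N -> vec f = 0 -> f = 0.
  move=> fD f0; rewrite (fE f fD) big1 // => m _.
  by have /rowP/(_ (enum_rank m)) := f0; rewrite !mxE enum_rankK => ->; rewrite scale0r.
have vecs (u : 'rV[F]_#|{: X}|) : exists2 f, (msize f <= D.+1)%N & vec f = u.
  exists (\sum_(m : X) u 0 (enum_rank m) *: 'X_[m]).
    by apply: mszsum => m; rewrite msizeX ltnS -ltnS bmdeg.
  apply/rowP => i; rewrite mxE raddf_sum /= (bigD1 (enum_val i)) //= big1 => [|m mi].
    by rewrite mcoeffZ mcoeffX eqxx mulr1 addr0 enum_valK.
  by rewrite mcoeffZ mcoeffX (_ : (_ == _) = false) ?mulr0 //; apply: negbTE.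
have Kinj a : row_free (map_mx (horner_eval a) K) -> forall f, (msize f <= D.+1)%N ->
    (forall c, l0 c f + a *: l1 c f = 0) -> (forall j, f@_(M j) = 0) -> f = 0.
  move=> fK f fD f0 f1; apply: vec_inj => //; apply: (row_free_inj fK).
  rewrite mul0mx; apply/rowP => i; rewrite -(enum_valK i) vK // [RHS]mxE.
  by case: (enum_val i) => [[c q]|j]; rewrite ?f0 ?mcoeff0.
have [bK bK0 bKP] : exists2 b : {poly F}, b.[0] != 0 & forall a, b.[a] != 0 ->
    row_free (map_mx (horner_eval a) K).
  apply: generic_row_free; rewrite -kermx_eq0 -submx0.
  apply/rV_subP => u /sub_kermxP; have [f fD <-] := vecs u => uK.
  have E (t : T) : match t with inl (c, q) => (l0 c f)@_q | inr j => f@_(M j) end = 0 :> F.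
    have := vK 0 f t fD; rewrite uK mxE.
    by case: t => [[c q]|j] ->; rewrite ?scale0r ?addr0.
  rewrite (_ : vec f = 0) ?sub0mx //; apply/rowP => i; rewrite !mxE.
  rewrite (_ : f = 0) ?mcoeff0 //; apply: inj0 => // [c|j]; last exact: (E (inr j)).
  apply/mpolyP => m; rewrite mcoeff0.
  have [mD'|D'm] := ltnP (mdeg m) D'; first exact: (E (inl (c, BMultinom mD'))).
  apply: memN_msupp_eq0; apply: msize_mdeg_ge; apply: leq_trans D'm.
  rewrite (fE f fD) (linS _ (lin0 c)).
  apply: (leq_trans (msize_sum _ _ _)); apply/bigmax_leqP_seq => q _ _.
  rewrite (leq_trans (msizeZ_le _ _)) //.
  by rewrite (leq_trans _ (leq_bigmax c)) // (leq_trans _ (leq_bigmax q)).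
(* The square matrix of marked coefficients of the [v i]; independence and [inj0] make it invertible
   at a = 0. *)
pose A : 'M[{poly F}]_#|J| :=
  \matrix_(i, j) map_poly (mcoeff (M (enum_val j))) (v (enum_val i)).
have AE a i j : map_mx (horner_eval a) A i j = ((v (enum_val i)).[a%:MP])@_(M (enum_val j)).
  rewrite !mxE /horner_eval [in RHS]horner_coef raddf_sum /=.
  rewrite (horner_coef_wide _ (size_poly _ _)); apply: eq_bigr => l _.
  by rewrite coef_map /= -rmorphXn [in RHS]mulrC mcoeffCM mulrC.
have [bA bA0 bAP] : exists2 b : {poly F}, b.[0] != 0 & forall a, b.[a] != 0 ->
    row_free (map_mx (horner_eval a) A).
  apply: generic_row_free; rewrite -kermx_eq0 -submx0.
  apply/rV_subP => u /sub_kermxP uA.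
  have u0 j : u 0 (enum_rank j) = 0.
    apply: (iv (fun j => u 0 (enum_rank j))); apply: inj0 => [|c|j'].
    - by apply: mszsum => k; have := vaD 0 k; rewrite mpolyC0.
    - rewrite (linS _ (lin0 c)) big1 // => k _.
      by have := vl 0 c k; rewrite mpolyC0 scale0r addr0 => ->; rewrite scaler0.
    - rewrite raddf_sum /=; have /rowP/(_ (enum_rank j')) := uA.
      rewrite !mxE (reindex (@enum_rank J)) /=; last first.
        by exists enum_val => ? _; rewrite ?enum_rankK ?enum_valK.
      move=> E; rewrite -[RHS]E; apply: eq_bigr => k _.
      by rewrite AE !enum_rankK mcoeffZ mpolyC0.
  rewrite (_ : u = 0) ?sub0mx //; apply/rowP => i; rewrite mxE -(enum_valK i).
  exact: u0.
exists (bK * bA) => [|a]; first by rewrite hornerM mulf_neq0.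
rewrite hornerM mulf_eq0 negb_or => /andP[/bKP fK /bAP fA] f fD f0.
(* [u] gives the combination of the [v j] with the same marked coefficients as [f]; the difference
   is a solution without marked coefficients, hence zero. *)
pose u := (\row_j f@_(M (enum_val j))) *m invmx (map_mx (horner_eval a) A).
have uE : u *m map_mx (horner_eval a) A = \row_j f@_(M (enum_val j)).
  by rewrite mulmxKV // -row_free_unit.
exists (fun j => u 0 (enum_rank j)); apply/eqP; rewrite -subr_eq0; apply/eqP.
apply: (Kinj a fK) => [|c|j].
- apply: (leq_trans (msizeD_le _ _)); rewrite msizeN geq_max fD /=.
  exact: mszsum.
- rewrite (linB _ (lin0 c)) (linB _ (lin1 c)) (linS _ (lin0 c)) (linS _ (lin1 c)) scalerBr addrACA
    f0 add0r -opprD scaler_sumr -big_split.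
  rewrite big1 ?oppr0 //= => j _.
  by rewrite scalerA [a * _]mulrC -scalerA -scalerDr vl scaler0.
- have /rowP/(_ (enum_rank j)) := uE; rewrite !mxE enum_rankK mcoeffB raddf_sum /= => <-.
  rewrite (reindex (@enum_rank J)) /=; last first.
    by exists enum_val => ? _; rewrite ?enum_rankK ?enum_valK.
  rewrite -sumrB big1 // => k _; rewrite AE !enum_rankK mcoeffZ.
  by rewrite /= subrr.
Qed.

(** * Augmented monomial symmetric functions *)

Definition psum (R : nzRingType) l (x : 'I_l -> R) (c : nat) : R := \sum_i x i ^+ c.

(* The augmented monomial symmetric function, in n parts. *)
Definition augm (R : nzRingType) l (x : 'I_l -> R) n (c : 'I_n -> nat) : R :=
  \sum_(t : {ffun 'I_n -> 'I_l} | injectiveb t) \prod_i x (t i) ^+ c i.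

Lemma augm0 (R : nzRingType) l (x : 'I_l -> R) (c : 'I_0 -> nat) : augm x c = 1.
Proof.
rewrite /augm (bigD1 (finfun (fun i : 'I_0 => match i return 'I_l with Ordinal m hm => False_rect
  _ (notF hm) end))) /=; last by apply/injectiveP => -[].
rewrite big_ord0 big1 ?addr0 // => t /andP[_ /eqP[]].
by apply/ffunP => -[].
Qed.

(** In the product of the power sum with the sum over injections, the new index either avoids all
    the others or meets exactly one of them, and then its exponent merges into that part. *)
Lemma augmS (R : comNzRingType) l (x : 'I_l -> R) n (c : 'I_n.+1 -> nat) :
  augm x c = psum x (c ord0) * augm x (fun i => c (lift ord0 i))
    - \sum_(j < n) augm x (fun i => (c (lift ord0 i) + (i == j) * c ord0)%N).
Proof.
apply/eqP; rewrite eq_sym subr_eq; apply/eqP.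
pose T := {ffun 'I_n -> 'I_l}.
pose w (t : T) := \prod_i x (t i) ^+ c (lift ord0 i).
have -> : \sum_(j < n) augm x (fun i => (c (lift ord0 i) + (i == j) * c ord0)%N)
    = \sum_(t : T | injectiveb t) \sum_(u | u \in codom t) x u ^+ c ord0 * w t.
  rewrite exchange_big; apply: eq_bigr => t /injectiveP it.
  transitivity (\sum_(u in [set t j | j in 'I_n]) x u ^+ c ord0 * w t); last first.
    by apply: eq_bigl => u; apply/imsetP/codomP => [[j _ ->]|[j ->]]; exists j.
  rewrite big_imset /=; last by move=> ? ? _ _ /it.
  apply: eq_bigr => j _; rewrite /w [in RHS](bigD1 j) // [in LHS](bigD1 j) //= eqxx mul1n.
  rewrite exprD mulrA; congr (_ * _); first by rewrite mulrC.
  by apply: eq_bigr => i /negbTE ->; rewrite addn0.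
have -> : augm x c =
    \sum_(t : T | injectiveb t) \sum_(u | u \notin codom t) x u ^+ c ord0 * w t.
  rewrite pair_big_dep /augm.
  pose h (p : T * 'I_l) : {ffun 'I_n.+1 -> 'I_l} :=
    [ffun i => oapp p.1 p.2 (unlift ord0 i)].
  pose h' (t : {ffun 'I_n.+1 -> 'I_l}) : T * 'I_l :=
    ([ffun i => t (lift ord0 i)], t ord0).
  have hK : cancel h h'.
    move=> [t u]; congr (_, _); last by rewrite ffunE unlift_none.
    by apply/ffunP => i; rewrite !ffunE liftK.
  have h'K : cancel h' h.
    move=> t; apply/ffunP => i; rewrite !ffunE.
    by case: unliftP => [j|] -> //=; rewrite ffunE.
  rewrite (reindex h) /=; last by exists h' => ? _; rewrite ?hK ?h'K.
  apply: eq_big => [[t u]|[t u] _] /=.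
    apply/injectiveP/andP => [ih|[/injectiveP it ut] i j].
      split; first apply/injectiveP => i j ij.
        by apply: (@lift_inj _ ord0); apply: ih; rewrite !ffunE !liftK.
      apply/negP => /codomP[j uj].
      suff /ih : h (t, u) ord0 = h (t, u) (lift ord0 j) by [].
      by rewrite !ffunE unlift_none liftK.
    rewrite !ffunE; case: unliftP => [i'|] ->; case: unliftP => [j'|] -> //=.
    - by move=> /it ->.
    - by move=> E; case/negP: ut; rewrite -E codom_f.
    - by move=> E; case/negP: ut; rewrite E codom_f.
  rewrite big_ord_recl ffunE unlift_none; congr (_ * _).
  by apply: eq_bigr => i _; rewrite ffunE liftK.
rewrite -big_split mulr_sumr; apply: eq_bigr => t _ /=.
rewrite addrC -mulr_suml /psum -/(w t) mulr_suml -mulr_suml [in LHS](bigID (fun u => u \in codom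
  t)).
by rewrite /= mulrDl -!mulr_suml.
Qed.

(** Read [A d f] as membership in degree d. The recurrence [augmS] builds augmented functions from
    power sums by products and differences, and it only ever adds exponents, which keeps them in
    [S]. *)
Lemma augm_closed (R : comNzRingType) (A : nat -> R -> Prop) (S : pred nat) l (x : 'I_l -> R) :
  A 0%N 1 -> (forall d e f g, A d f -> A e g -> A (d + e)%N (f * g)) ->
  (forall d f g, A d f -> A d g -> A d (f - g)) ->
  (forall c d, S c -> S d -> S (c + d)%N) ->
  (forall c, S c -> A c (psum x c)) ->
  forall n (c : 'I_n -> nat), (forall i, S (c i)) -> A (\sum_i c i)%N (augm x c).
Proof.
move=> A1 AM AB SD Ap; elim=> [|n IHn] c Sc; first by rewrite augm0 big_ord0.
rewrite augmS big_ord_recl.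
have A0 d f : A d f -> A d 0 by move=> Af; rewrite -(subrr f); apply: AB.
have AN d f : A d f -> A d (- f) by move=> Af; rewrite -[- f]add0r; apply: AB (A0 _ _ Af) Af.
have AD d f g : A d f -> A d g -> A d (f + g).
  by move=> Af Ag; rewrite -[g]opprK; apply: AB => //; apply: AN.
have AM1 : A (c ord0 + \sum_(i < n) c (lift ord0 i))%N
    (psum x (c ord0) * augm x (fun i => c (lift ord0 i))).
  by apply: AM; [apply: Ap|apply: IHn].
apply: AB => //; apply: (big_ind (A _)) => [|f g Af Ag|j _]; [exact: (A0 _ _ AM1)|exact: AD|].
have -> : (c ord0 + \sum_(i < n) c (lift ord0 i) =
    \sum_(i < n) (c (lift ord0 i) + (i == j) * c ord0))%N.
  rewrite big_split /= addnC; congr (_ + _)%N.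
  rewrite (bigD1 j) //= eqxx mul1n big1 ?addn0 // => i /negbTE ->.
  by rewrite mul0n.
apply: IHn => i; case: eqP => _; rewrite ?mul1n ?addn0 //.
by apply: SD.
Qed.

Lemma augm_eq0 (R : comNzRingType) l (x : 'I_l -> R) n (c : 'I_n -> nat) :
  (l < n)%N -> augm x c = 0.
Proof.
move=> ln; rewrite /augm big1 // => t /injectiveP it.
by have := leq_card _ it; rewrite !card_ord leqNgt ln.
Qed.

(** * The algebra of deformed Newton sums and its families *)

Lemma mpoly_rmorph_ext (R S : comNzRingType) n (f g : {rmorphism {mpoly R[n]} -> S}) :
  (forall c, f c%:MP = g c%:MP) -> (forall i, f 'X_i = g 'X_i) -> f =1 g.
Proof.
move=> fgC fgX p; rewrite (mpolyE p) !rmorph_sum; apply: eq_bigr => m _.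
rewrite -mul_mpolyC !rmorphM fgC mpolyXE_id !rmorph_prod; congr (_ * _).
by apply: eq_bigr => i _; rewrite !rmorphXn /= fgX.
Qed.

Lemma mpoly_alg_ind (R : comNzRingType) n (Q : {mpoly R[n]} -> Prop) :
  (forall c, Q c%:MP) -> (forall i, Q 'X_i) ->
  (forall f g, Q f -> Q g -> Q (f + g)) -> (forall f g, Q f -> Q g -> Q (f * g)) ->
  forall f, Q f.
Proof.
move=> QC QX QD QM f.
have Q0 : Q 0 by rewrite -mpolyC0; apply: QC.
have Q1 : Q 1 by rewrite -mpolyC1; apply: QC.
rewrite (mpolyE f); apply: (big_ind Q) => // m _; rewrite -mul_mpolyC mpolyXE_id.
apply: (QM); first exact: QC.
apply: (big_ind Q) => // i _; elim: (m i) => [|e IHe]; first by rewrite expr0.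
by rewrite exprS; apply: (QM).
Qed.

Section Substitution.
Variables (R : comNzRingType) (n m : nat).
Implicit Types (h : 'I_n -> {mpoly R[m]}).

Definition msubst h : {mpoly R[n]} -> {mpoly R[m]} := comp_mpoly [tuple h i | i < n].

HB.instance Definition _ h := GRing.LRMorphism.copy (msubst h) (comp_mpoly [tuple h i | i < n]).

Lemma msubstX h i : msubst h 'X_i = h i.
Proof. by rewrite /msubst comp_mpolyXU -tnth_nth tnth_mktuple. Qed.

Lemma msubstC h c : msubst h c%:MP = c%:MP.
Proof. exact: comp_mpolyC. Qed.

End Substitution.

Lemma msubst_comp (R : comNzRingType) n m l (h : 'I_n -> {mpoly R[m]}) (g : 'I_m -> {mpoly R[l]})
  p :
  msubst g (msubst h p) = msubst (fun i => msubst g (h i)) p.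
Proof.
apply: (@mpoly_rmorph_ext _ _ _ (msubst g \o msubst h) (msubst _)) => [c|i] /=.
  by rewrite !msubstC.
by rewrite !msubstX.
Qed.

Lemma char0_natr_neq0 (F : fieldType) m : [pchar F] =i pred0 -> (0 < m)%N -> m%:R != 0 :> F.
Proof. by move=> charF m0; rewrite (pcharf0P F).1 // -lt0n. Qed.

Lemma coef_linear0 (R : nzRingType) (p q : R) : (p%:P * 'X + q%:P)`_0 = q.
Proof. by rewrite coefD coefMX !coefC add0r. Qed.

Lemma coef_linear1 (R : nzRingType) (p q : R) : (p%:P * 'X + q%:P)`_1 = p.
Proof. by rewrite coefD coefMX !coefC addr0. Qed.

Lemma coef1M (R : nzRingType) (p q : {poly R}) : (p * q)`_1 = p`_0 * q`_1 + p`_1 * q`_0.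
Proof. by rewrite coefM !big_ord_recl big_ord0 addr0. Qed.

Section NewtonAlgebra.
Variables (F : fieldType) (r s : nat).
Local Notation P := {mpoly F[r + s]}.

Definition yvar (i : 'I_r) : P := 'X_(lshift s i).
Definition zvar (j : 'I_s) : P := 'X_(rshift r j).

Definition newton (a : F) (c : nat) : P := a *: psum yvar c + psum zvar c.

Definition newton_alg (a : F) (p : P) : Prop :=
  exists (m : nat) (q : {mpoly F[m]}), p = msubst (fun i => newton a i.+1) q.

(** Lets two elements be written in the same number of Newton sums before they are combined. *)
Lemma newton_alg_widen a m m' (q : {mpoly F[m]}) : (m <= m')%N ->
  exists q' : {mpoly F[m']},
    msubst (fun i => newton a i.+1) q' = msubst (fun i => newton a i.+1) q.
Proof.
move=> mm; exists (msubst (fun i => 'X_(widen_ord mm i)) q); rewrite msubst_comp.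
apply: (mpoly_rmorph_ext (f := msubst _) (g := msubst _)) => [c|i] /=; first by rewrite !msubstC.
by rewrite !msubstX.
Qed.

Lemma newton_alg_op2 a (op : forall m, {mpoly F[m]} -> {mpoly F[m]} -> {mpoly F[m]}) :
  (forall m (h : 'I_m -> P), {morph msubst h : p q / op _ p q}) ->
  forall p q, newton_alg a p -> newton_alg a q -> newton_alg a (op _ p q).
Proof.
move=> opE _ _ [m [p ->]] [m' [q ->]].
have [p' <-] := newton_alg_widen a p (leq_maxl m m').
have [q' <-] := newton_alg_widen a q (leq_maxr m m').
by exists (maxn m m'), (op _ p' q'); rewrite opE.
Qed.

Lemma newton_algM a p q : newton_alg a p -> newton_alg a q -> newton_alg a (p * q).
Proof. by apply: (@newton_alg_op2 a (fun m => *%R)) => m h; apply: rmorphM. Qed.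

Lemma newton_algB a p q : newton_alg a p -> newton_alg a q -> newton_alg a (p - q).
Proof. by apply: (@newton_alg_op2 a (fun m x y => x - y)) => m h; apply: rmorphB. Qed.

Lemma newton_algC a c : newton_alg a c%:MP.
Proof. by exists 0%N, c%:MP; rewrite msubstC. Qed.

Lemma newton_algZ a c p : newton_alg a p -> newton_alg a (c *: p).
Proof. by rewrite -mul_mpolyC; apply: newton_algM; apply: newton_algC. Qed.

Lemma newton_alg0 a : newton_alg a 0.
Proof. by rewrite -mpolyC0; apply: newton_algC. Qed.

Lemma newton_alg1 a : newton_alg a 1.
Proof. by rewrite -mpolyC1; apply: newton_algC. Qed.

Lemma newton_algD a p q : newton_alg a p -> newton_alg a q -> newton_alg a (p + q).
Proof.
move=> pA qA; rewrite -[q]opprK -[- q]add0r; apply: newton_algB => //.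
by apply: newton_algB => //; apply: newton_alg0.
Qed.

Lemma newton_alg_newton a c : newton_alg a (newton a c.+1).
Proof. by exists c.+1, 'X_ord_max; rewrite msubstX. Qed.

Lemma newton_alg_sum a (I : Type) (q : seq I) (Q : pred I) (f : I -> P) :
  (forall i, Q i -> newton_alg a (f i)) -> newton_alg a (\sum_(i <- q | Q i) f i).
Proof.
by move=> fA; apply: big_ind => //; [apply: newton_alg0|apply: newton_algD].
Qed.

Lemma newton_algX a p e : newton_alg a p -> newton_alg a (p ^+ e).
Proof.
move=> pA; elim: e => [|e IHe]; first exact: newton_alg1.
by rewrite exprS; apply: newton_algM.
Qed.

Lemma newton_alg_msubst a m (h : 'I_m -> P) q :
  (forall i, newton_alg a (h i)) -> newton_alg a (msubst h q).
Proof.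
move=> hA; rewrite (mpolyE q) raddf_sum; apply: newton_alg_sum => e _ /=.
rewrite linearZ; apply: newton_algZ; rewrite mpolyXE_id rmorph_prod.
apply: big_ind => [||i _]; [exact: newton_alg1|exact: newton_algM|].
by rewrite rmorphXn /= msubstX; apply: newton_algX.
Qed.

(* One-parameter families of polynomials are elements of {poly P}, the variable being the
   parameter a: the member of the family f at a is f.[a%:MP]. *)
Definition newton_fam (d : nat) (f : {poly P}) : Prop :=
  (forall a, a != 0 -> newton_alg a f.[a%:MP]) /\ (forall i, f`_i \is d.-homog).

Lemma newton_fam_const d (p : F) : d = 0%N -> newton_fam d (p%:MP)%:P.
Proof.
move=> ->; split=> [a _|i]; first by rewrite hornerC; apply: newton_algC.
rewrite coefC; case: eqP => _; last exact: dhomog0.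
by rewrite -[p%:MP]mulr1 mul_mpolyC; apply: dhomogZ; apply: dhomog1.
Qed.

Lemma newton_famM d e f g : newton_fam d f -> newton_fam e g -> newton_fam (d + e) (f * g).
Proof.
move=> [fA fH] [gA gH]; split=> [a a0|i]; first by rewrite hornerM; apply: newton_algM; auto.
by rewrite coefM; apply: rpred_sum => j _; apply: dhomogM.
Qed.

Lemma newton_famB d f g : newton_fam d f -> newton_fam d g -> newton_fam d (f - g).
Proof.
move=> [fA fH] [gA gH]; split=> [a a0|i].
  by rewrite hornerD hornerN; apply: newton_algB; auto.
by rewrite coefB rpredB.
Qed.

Lemma newton_famZ d c f : newton_fam d f -> newton_fam d (c%:MP *: f).
Proof.
by move=> fA; rewrite -mul_polyC -[d]add0n; apply: newton_famM => //; apply: newton_fam_const.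
Qed.

Lemma psum_homog l (x : 'I_l -> P) c : (forall i, x i \is 1.-homog) -> psum x c \is c.-homog.
Proof.
by move=> xH; apply: rpred_sum => i _; have := dhomogMn c (xH i); rewrite mul1n.
Qed.

Lemma yvar_homog i : yvar i \is 1.-homog.
Proof. by rewrite dhomogX /= mdeg1. Qed.

Lemma zvar_homog i : zvar i \is 1.-homog.
Proof. by rewrite dhomogX /= mdeg1. Qed.

Definition newton_lift (c : nat) : {poly P} := (psum yvar c)%:P * 'X + (psum zvar c)%:P.

Lemma size_newton_lift c : (size (newton_lift c) <= 2)%N.
Proof.
apply: leq_trans (size_polyD _ _) _; rewrite geq_max (leq_trans (size_polyC_leq1 _)) // andbT.
by apply: leq_trans (size_polyMleq _ _) _; rewrite size_polyX addn2 ltnS size_polyC_leq1.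
Qed.

Lemma newton_lift0 c : (newton_lift c)`_0 = psum zvar c.
Proof. exact: coef_linear0. Qed.

Lemma newton_lift1 c : (newton_lift c)`_1 = psum yvar c.
Proof. exact: coef_linear1. Qed.

Lemma newton_lift_fam c : newton_fam c.+1 (newton_lift c.+1).
Proof.
split=> [a a0|i].
  rewrite /newton_lift hornerD hornerM !hornerC hornerX mulrC mul_mpolyC.
  exact: newton_alg_newton.
have yH : psum yvar c.+1 \is c.+1.-homog by apply: psum_homog => j; apply: yvar_homog.
have zH : psum zvar c.+1 \is c.+1.-homog by apply: psum_homog => j; apply: zvar_homog.
case: i => [|[|i]]; first by rewrite newton_lift0.
  by rewrite newton_lift1.
rewrite nth_default ?dhomog0 //; exact: leq_trans (size_newton_lift _) _.
Qed.

(** At a = 0 the Newton sum is the power sum in z, so being the value at 0 of a family in the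
    algebra passes from power sums to all augmented functions. *)
Lemma augm_zvar_lift n (c : 'I_n -> nat) :
  exists2 f, newton_fam (\sum_i c i) f & f`_0 = augm zvar c.
Proof.
pose A d p := exists2 f, newton_fam d f & f`_0 = p.
apply: (@augm_closed _ A predT _ zvar) => //.
- by exists 1; rewrite ?coef1 //; have := newton_fam_const 1 (erefl 0%N); rewrite mpolyC1.
- move=> d e _ _ [f fA <-] [g gA <-]; exists (f * g); first exact: newton_famM.
  by rewrite coef0M.
- move=> d _ _ [f fA <-] [g gA <-]; exists (f - g); first exact: newton_famB.
  by rewrite coefB.
(* The exponent 0 is not covered by the generators, but its power sum is the constant s. *)
- move=> [|e] _; last by exists (newton_lift e.+1); rewrite ?newton_lift0 //;
    apply: newton_lift_fam.
  exists ((s%:R)%:MP)%:P; first exact: newton_fam_const.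
  rewrite coefC /psum; under eq_bigr do rewrite expr0.
  by rewrite sumr_const card_ord mpolyC_nat.
Qed.

(** * Reduction modulo z, and division of families by the parameter *)

Definition kill_z : P -> P := msubst (fun i => if (i < r)%N then 'X_i else 0).
HB.instance Definition _ := GRing.LRMorphism.copy kill_z (msubst (fun i => if (i < r)%N then 'X_i
  else 0)).

Lemma kill_z_yvar i : kill_z (yvar i) = yvar i.
Proof. by rewrite /kill_z msubstX /= ltn_ord. Qed.

Lemma kill_z_zvar i : kill_z (zvar i) = 0.
Proof. by rewrite /kill_z msubstX /= ltnNge leq_addr. Qed.

Lemma kill_z_psum c : (0 < c)%N -> kill_z (psum zvar c) = 0.
Proof.
move=> c0; rewrite raddf_sum big1 // => i _.
by rewrite /= rmorphXn /= kill_z_zvar expr0n eqn0Ngt c0.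
Qed.

Lemma kill_z_augm n (c : 'I_n.+1 -> nat) :
  (forall i, (0 < c i)%N) -> kill_z (augm zvar c) = 0.
Proof.
move=> c0; rewrite raddf_sum big1 // => t _.
by rewrite /= rmorph_prod big_ord_recl rmorphXn /= kill_z_zvar expr0n eqn0Ngt c0 mul0r.
Qed.

(* The a-linear part of a lift of an augmented monomial function in n+1 parts comes, modulo z,
   only from the total merge of the parts. *)
Lemma augm_zvar_lift1 n (c : 'I_n.+1 -> nat) : (forall i, (0 < c i)%N) ->
  exists f, [/\ newton_fam (\sum_i c i) f, f`_0 = augm zvar c &
    kill_z f`_1 = (-1) ^+ n * n`!%:R * psum yvar (\sum_i c i)].
Proof.
elim: n c => [|n IHn] c c0.
  exists (newton_lift (c ord0)); rewrite big_ord1; split.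
  - by have := c0 ord0; case: (c ord0) => // e _; apply: newton_lift_fam.
  - by rewrite newton_lift0 augmS augm0 mulr1 big_ord0 subr0.
  rewrite newton_lift1 expr0 !mul1r raddf_sum; apply: eq_bigr => i _.
  by rewrite /= rmorphXn /= kill_z_yvar.
have [f1 [f1A f10 f11]] := IHn (fun i => c (lift ord0 i)) (fun i => c0 _).
have sumE j : (c ord0 + \sum_(i < n.+1) c (lift ord0 i) =
    \sum_(i < n.+1) (c (lift ord0 i) + (i == j) * c ord0))%N.
  rewrite big_split /= addnC; congr (_ + _)%N.
  rewrite (bigD1 j) //= eqxx mul1n big1 ?addn0 // => i /negbTE ->.
  by rewrite mul0n.
have /fin_all_exists[g gP] j := IHn (fun i => (c (lift ord0 i) + (i == j) * c ord0)%N)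
   (fun i => ltn_addr _ (c0 _)).
exists (newton_lift (c ord0) * f1 - \sum_j g j); rewrite big_ord_recl.
split.
- apply: newton_famB.
    apply: newton_famM => //.
    by have := c0 ord0; case: (c ord0) => // e _; apply: newton_lift_fam.
  apply: (big_ind (newton_fam _)) => [|u v uA vA|j _].
  + rewrite -(subrr (g ord0)) (sumE ord0); have [? _ _] := gP ord0; exact: newton_famB.
  + rewrite -[v]opprK -[- v]add0r; apply: newton_famB => //; apply: newton_famB => //.
    by rewrite -(subrr v); apply: newton_famB.
  + by rewrite (sumE j); have [] := gP j.
- rewrite augmS coefB coef0M newton_lift0 f10 coef_sum; congr (_ - _).
  by apply: eq_bigr => j _; have [_ ->] := gP j.
(* In the linear coefficient of the product every term has a factor, a power sum or augmented
   function in z, that dies modulo z. The n+1 merged terms contribute equally, so each new part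
   multiplies the constant by -(n+1). *)
rewrite coefB coef1M newton_lift0 newton_lift1 f10.
rewrite rmorphB rmorphD !rmorphM /= kill_z_psum // kill_z_augm // mul0r mulr0 add0r sub0r.
pose x : P := (-1) ^+ n * n`!%:R * psum yvar (\sum_i c i).
have -> : kill_z (\sum_j g j)`_1 = x *+ n.+1.
  rewrite coef_sum raddf_sum -[n.+1 in RHS]card_ord -sumr_const; apply: eq_bigr => j _.
  by have [_ _ /= ->] := gP j; rewrite -sumE /x [in RHS]big_ord_recl.
rewrite -[in RHS]big_ord_recl /x -mulrnAl exprS mulN1r !mulNr; congr (- (_ * _)).
by rewrite -mulr_natr -mulrA -natrM mulnC.
Qed.

Hypothesis charF : [pchar F] =i pred0.

(** Split c into s+1 positive parts, s of them equal to 1. The augmented function of s+1 parts in s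
    variables is zero, so its lift is divisible by the parameter; the quotient has at a = 0, modulo
    z, the value (-1)^s s! p_c(y), and the constant is invertible in characteristic 0. *)
Lemma psum_yvar_lift c : (s < c)%N ->
  exists2 f, newton_fam c f & kill_z f`_0 = psum yvar c.
Proof.
move=> sc; pose e (i : 'I_s.+1) := if i == ord_max then (c - s)%N else 1%N.
have eE : (\sum_i e i)%N = c.
  rewrite big_ord_recr /= /e eqxx (eq_bigr (fun=> 1%N)) => [|i _].
    by rewrite sum_nat_const card_ord muln1 subnKC // ltnW.
  by rewrite -val_eqE /= ltn_eqF.
have [|f [[fA fH] f0 f1]] := @augm_zvar_lift1 s e.
  by move=> i; rewrite /e; case: eqP; rewrite ?subn_gt0.
rewrite eE in f1 fH; rewrite augm_eq0 // in f0.
pose u : F := (-1) ^+ s * s`!%:R.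
have u0 : u != 0 by rewrite mulf_neq0 ?signr_eq0 // char0_natr_neq0 // fact_gt0.
(* The quotient of [f] by the parameter. For a nonzero its member is a scalar multiple of a member
   of [f], so it stays in the algebra; at a = 0 it gives a new limit. *)
pose g : {poly P} := \poly_(i < size f) f`_i.+1.
have gE i : g`_i = f`_i.+1.
  rewrite coef_poly; case: ltnP => // fi; rewrite nth_default //.
  exact: leq_trans fi _.
have fE : f = g * 'X.
  by apply/polyP => -[|i]; rewrite coefMX ?f0 //= gE.
exists ((u^-1)%:MP *: g).
  apply: newton_famZ; split=> [a a0|i]; last by rewrite gE.
  have := newton_algZ a^-1 (fA a a0); rewrite fE hornerM hornerX mulrC mul_mpolyC scalerA.
  by rewrite mulVf // scale1r.
rewrite coefZ gE mul_mpolyC linearZ /= f1.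
have -> : (-1) ^+ s * s`!%:R = u%:MP :> P.
  by rewrite mpolyCM rmorphXn /= mpolyCN mpolyC1 mpolyC_nat.
by rewrite mul_mpolyC scalerA mulVf // scale1r.
Qed.

(** The exponents 0 and those above s form a set closed under addition whose power sums all lift, so
    [augm_closed] applies. *)
Lemma augm_yvar_lift n (c : 'I_n -> nat) :
  (forall i, c i = 0%N \/ (s < c i)%N) ->
  exists2 f, newton_fam (\sum_i c i) f & kill_z f`_0 = augm yvar c.
Proof.
move=> cP; pose A d p := exists2 f, newton_fam d f & kill_z f`_0 = p.
apply: (@augm_closed _ A (fun e => (e == 0%N) || (s < e)%N) _ yvar).
- exists 1; rewrite ?coef1 ?rmorph1 //.
  by have := newton_fam_const 1 (erefl 0%N); rewrite mpolyC1.
- move=> d e _ _ [f fA <-] [g gA <-]; exists (f * g); first exact: newton_famM.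
  by rewrite coef0M rmorphM.
- move=> d _ _ [f fA <-] [g gA <-]; exists (f - g); first exact: newton_famB.
  by rewrite coefB rmorphB.
- move=> d e /orP[/eqP ->|sd] // _; apply/orP; right; exact: ltn_addr.
- move=> e /orP[/eqP ->|]; last exact: psum_yvar_lift.
  exists ((r%:R)%:MP)%:P; first exact: newton_fam_const.
  rewrite coefC /psum; under eq_bigr do rewrite expr0.
  by rewrite sumr_const card_ord mpolyC_nat rmorph_nat.
- by move=> i; have [->|->] := cP i; rewrite ?orbT.
Qed.

End NewtonAlgebra.

(** * Partitions *)

(** With as many parts as variables the injections are permutations, and inversion moves them from
    the variables to the exponents. *)
Lemma augm_perm (R : comNzRingType) l (x : 'I_l -> R) (c : 'I_l -> nat) :
  augm x c = \sum_(p : 'S_l) \prod_i x i ^+ c (p i).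
Proof.
rewrite /augm (reindex_onto (fun p : 'S_l => [ffun i => p i]) (fun t => insubd (1%g : 'S_l) t)) /=.
  rewrite (reindex_inj invg_inj) /=; apply: eq_big => [p|p _].
    have ip : injectiveb (finfun p^-1%g) by apply/injectiveP => i j; rewrite !ffunE => /perm_inj.
    rewrite ip /=; apply/eqP/val_inj; rewrite val_insubd ip.
    by apply/ffunP => i; rewrite ffunE fun_of_perm.unlock.
  rewrite (reindex_inj (@perm_inj _ p)) /=.
  by apply: eq_bigr => i _; rewrite ffunE permK.
by move=> t it; apply/ffunP => i; rewrite ffunE fun_of_perm.unlock val_insubd it.
Qed.

Section Cumulative.
Variable l : nat.
Implicit Types (d m : 'I_l -> nat).

Definition nonincr m := forall i j : 'I_l, (i <= j)%N -> (m j <= m i)%N.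

(** Encodes a partition by its column multiplicities: [d b] is the number of columns of height b+1
    in the diagram, and any [d] is allowed. The inverse is [dif]. *)
Definition cum d (a : 'I_l) : nat := (\sum_(b < l | a <= b) d b)%N.

(** The default 0 past the end makes the last difference equal to the last part. *)
Definition succ_val m (a : 'I_l) : nat := if insub a.+1 is Some a' then m a' else 0%N.

Definition dif m (a : 'I_l) : nat := (m a - succ_val m a)%N.

Lemma cum_rec d a : cum d a = (d a + succ_val (cum d) a)%N.
Proof.
rewrite /cum /succ_val (bigD1 a) //=; congr addn; case: insubP => [a' _ a'E|].
  by apply: eq_bigl => b; rewrite -val_eqE /= a'E; lia.
move=> al; rewrite big1 // => b /andP[ab]; rewrite -val_eqE /=.
have := ltn_ord b; lia.
Qed.

Lemma cum_nonincr d : nonincr (cum d).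
Proof.
move=> i j ij; rewrite /cum big_mkcond [X in (_ <= X)%N]big_mkcond.
by apply: leq_sum => b _; case: (leqP j b) => // jb; rewrite (leq_trans ij jb).
Qed.

Lemma dif_cum d : dif (cum d) =1 d.
Proof. by move=> a; rewrite /dif cum_rec addnK. Qed.

Lemma cum_dif m : nonincr m -> cum (dif m) =1 m.
Proof.
move=> dm a; have [q] := ubnP (l - a); elim: q a => // q IHq a aq.
rewrite cum_rec {1}/dif; suff -> : succ_val (cum (dif m)) a = succ_val m a.
  rewrite subnK // /succ_val; case: insubP => //= a' _ a'E.
  by apply: dm; rewrite a'E.
rewrite /succ_val; case: insubP => //= a' _ a'E; apply: IHq; rewrite a'E.
by have := ltn_ord a; lia.
Qed.

(** Two sorted arrangements of the same list coincide. *)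
Lemma nonincr_perm m (p : 'S_l) : nonincr m -> nonincr (fun i => m (p i)) ->
  forall i, m (p i) = m i.
Proof.
move=> dm dmp.
have srt u : nonincr u -> sorted geq [seq u i | i <- enum 'I_l].
  move=> du; rewrite sorted_map.
  apply: (@sub_sorted _ (relpre val leq)) => [i j|]; first exact: du.
  by rewrite -sorted_map val_enum_ord iota_sorted.
have E : [seq m (p i) | i <- enum 'I_l] = [seq m i | i <- enum 'I_l].
  apply: (sorted_eq (leT := geq)) (srt _ dmp) (srt _ dm) _ => [x y z /= xy yz||].
  - exact: leq_trans yz xy.
  - by move=> x y /=; rewrite andbC -eqn_leq => /eqP.
  rewrite (map_comp m (fun i => p i)); apply: perm_map; apply: uniq_perm; rewrite ?enum_uniq //.
    by rewrite map_inj_uniq ?enum_uniq //; apply: perm_inj.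
  move=> i; rewrite mem_enum; apply/mapP; exists (p^-1%g i); rewrite ?mem_enum ?permKV //.
by move=> i; move/eq_in_map: E => /(_ i); rewrite mem_enum; apply.
Qed.
End Cumulative.

(** Among the indices with nonzero coefficient, the one with the largest leading monomial
    contributes a term that nothing can cancel. *)
Lemma lin_indep_lead (F : fieldType) n (J : finType) (v : J -> {mpoly F[n]}) :
  (forall j, v j != 0) -> injective (fun j => mlead (v j)) -> lin_indep v.
Proof.
move=> v0 iv c cv j0; apply/eqP/negPn/negP => cj0.
pose S := [seq j <- enum J | c j != 0].
have [j1 j1S j1max] : exists2 j1, c j1 != 0 & forall j, c j != 0 -> (mlead (v j) <= mlead (v j1))%O.
  have : j0 \in S by rewrite mem_filter cj0 mem_enum.
  have SE j : (c j != 0) = (j \in S) by rewrite mem_filter mem_enum andbT.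
  have [j1 j1S j1P] : exists2 j1, j1 \in j0 :: S & forall j, j \in j0 :: S -> (mlead (v j) <=
    mlead (v j1))%O.
    elim: S {SE} j0 {cj0} => [|x S IHS] j0.
      by exists j0; rewrite ?mem_seq1 // => j; rewrite mem_seq1 => /eqP ->.
    have [j1 j1S j1P] := IHS x.
    have [le|lt] := Order.TotalTheory.leP (mlead (v j0)) (mlead (v j1)).
      exists j1; first by rewrite in_cons j1S orbT.
      by move=> j; rewrite in_cons => /orP[/eqP ->|/j1P].
    exists j0; first by rewrite mem_head.
    move=> j; rewrite in_cons => /orP[/eqP ->|/j1P] //.
    by move=> /Order.POrderTheory.le_trans; apply; apply: Order.POrderTheory.ltW.
  move=> j0S; exists j1; last by move=> j; rewrite SE => jS; apply: j1P; rewrite in_cons jS orbT.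
  by rewrite SE; move: j1S; rewrite in_cons => /orP[/eqP ->|].
have /(congr1 (mcoeff (mlead (v j1)))) := cv.
rewrite raddf_sum (bigD1 j1) //= big1 => [|j jj1].
  rewrite addr0 mcoeffZ mcoeff0 => /eqP; rewrite mulf_eq0 (negPf j1S) /=.
  by rewrite mleadc_eq0 (negPf (v0 _)).
rewrite mcoeffZ; have [->|cj] := eqVneq (c j) 0; first by rewrite mul0r.
rewrite mcoeff_gt_mlead ?mulr0 // Order.POrderTheory.lt_neqAle j1max // andbT.
by apply: contra_neq jj1 => /iv.
Qed.

(** * Block-symmetric polynomials *)

Section Blocks.
Variables (r s : nat).
Local Notation n := (r + s)%N.
Local Notation l := (@lshift r s).
Local Notation rr := (@rshift r s).
Local Notation "m # p" := [multinom m (p i) | i < n] (at level 40, left associativity).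

Definition bmnm (u : 'I_r -> nat) (v : 'I_s -> nat) : 'X_{1..n} :=
  [multinom match split i with inl a => u a | inr b => v b end | i < n].

Lemma bmnm_l u v a : bmnm u v (l a) = u a.
Proof. by rewrite mnmE -[lshift s a]/(unsplit (inl a)) unsplitK. Qed.

Lemma bmnm_r u v b : bmnm u v (rr b) = v b.
Proof. by rewrite mnmE -[rshift r b]/(unsplit (inr b)) unsplitK. Qed.

Lemma bmnmP (m1 m2 : 'X_{1..n}) :
  (forall a, m1 (l a) = m2 (l a)) -> (forall b, m1 (rr b) = m2 (rr b)) -> m1 = m2.
Proof. by move=> El Er; apply/mnmP => i; case: (split_ordP i) => [a|b] ->. Qed.

Definition block (i j : 'I_n) : bool := (i < r)%N == (j < r)%N.

Lemma block_l a b : block (l a) (l b).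
Proof. by rewrite /block /= !ltn_ord. Qed.

Lemma block_r a b : block (rr a) (rr b).
Proof. by rewrite /block /= !ltnNge !leq_addr. Qed.

Lemma blockP i j : block i j ->
  (exists a b, i = l a /\ j = l b) \/ (exists a b, i = rr a /\ j = rr b).
Proof.
case: (split_ordP i) => [a ->|a ->]; case: (split_ordP j) => [b ->|b ->].
- by left; exists a, b.
- by rewrite /block /= ltn_ord ltnNge leq_addr.
- by rewrite /block /= ltn_ord ltnNge leq_addr.
- by right; exists a, b.
Qed.

Lemma tperm_ll a b c : tperm (l a) (l b) (l c) = l (tperm a b c).
Proof. by rewrite (inj_tperm _ _ _ (@lshift_inj _ _)). Qed.

Lemma tperm_rr a b c : tperm (rr a) (rr b) (rr c) = rr (tperm a b c).
Proof. by rewrite (inj_tperm _ _ _ (@rshift_inj _ _)). Qed.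

Lemma tperm_lr a b c : tperm (l a) (l b) (rr c) = rr c.
Proof. by rewrite tpermD // eq_lrshift. Qed.

Lemma tperm_rl a b c : tperm (rr a) (rr b) (l c) = l c.
Proof. by rewrite tpermD // eq_rlshift. Qed.

Lemma bmnm_tperm_l u v a b : bmnm u v # tperm (l a) (l b) = bmnm (fun c => u (tperm a b c)) v.
Proof.
by apply: bmnmP => c; rewrite mnmE ?bmnm_l ?bmnm_r ?tperm_ll ?tperm_lr ?bmnm_l ?bmnm_r.
Qed.

Lemma bmnm_tperm_r u v a b : bmnm u v # tperm (rr a) (rr b) = bmnm u (fun c => v (tperm a b c)).
Proof.
by apply: bmnmP => c; rewrite mnmE ?bmnm_l ?bmnm_r ?tperm_rr ?tperm_rl ?bmnm_l ?bmnm_r.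
Qed.

Lemma eq_bmnm u u' v v' : u =1 u' -> v =1 v' -> bmnm u v = bmnm u' v'.
Proof. by move=> uE vE; apply: bmnmP => c; rewrite ?bmnm_l ?bmnm_r. Qed.

Lemma bmnm_id (m : 'X_{1..n}) : m = bmnm (fun a => m (l a)) (fun b => m (rr b)).
Proof. by apply: bmnmP => c; rewrite ?bmnm_l ?bmnm_r. Qed.

Definition bdec (m : 'X_{1..n}) := nonincr (fun a => m (l a)) /\ nonincr (fun b => m (rr b)).

Lemma lt_tperm (m : 'X_{1..n}) (i j : 'I_n) : (i <= j)%N -> (m i < m j)%N -> (m < m # tperm i j)%O.
Proof.
move=> le_ij h; apply/ltmcP; first by rewrite mdeg_mperm.
exists i => [c lt_ci|]; last by rewrite mnmE tpermL.
rewrite mnmE tpermD // neq_ltn orbC ?lt_ci //.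
by move/leq_trans: lt_ci => /(_ _ le_ij) ->.
Qed.

Lemma not_bdec (m : 'X_{1..n}) : ~ bdec m ->
  exists i j, block i j /\ (m < m # tperm i j)%O.
Proof.
move=> nd.
have [/forallP dl|/forallPn[i /forallPn[j]]] :=
    boolP [forall i : 'I_r, forall j : 'I_r, (i <= j)%N ==> (m (l j) <= m (l i))%N]; last first.
  rewrite negb_imply -ltnNge => /andP[ij mij]; exists (l i), (l j).
  by split; [apply: block_l|apply: lt_tperm].
have [/forallP dr|/forallPn[i /forallPn[j]]] :=
    boolP [forall i : 'I_s, forall j : 'I_s, (i <= j)%N ==> (m (rr j) <= m (rr i))%N]; last first.
  rewrite negb_imply -ltnNge => /andP[ij mij]; exists (rr i), (rr j).
  by split; [apply: block_r|apply: lt_tperm; rewrite //= leq_add2l].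
by case: nd; split=> i j ij; [have /forallP/(_ j)/implyP := dl i|have /forallP/(_ j)/implyP := dr
  i]; apply.
Qed.

Lemma bdecP (m : 'X_{1..n}) : {bdec m} + {~ bdec m}.
Proof.
pose b := [forall i : 'I_r, forall j : 'I_r, (i <= j)%N ==> (m (l j) <= m (l i))%N] &&
  [forall i : 'I_s, forall j : 'I_s, (i <= j)%N ==> (m (rr j) <= m (rr i))%N].
have [/andP[/forallP dl /forallP dr]|nb] := boolP b.
  left; split=> i j ij; [have /forallP/(_ j)/implyP := dl i|have /forallP/(_ j)/implyP := dr i];
    exact.
right=> -[dl dr]; case/negP: nb; apply/andP; split; apply/forallP => i; apply/forallP => j;
  apply/implyP; [exact: dl|exact: dr].
Qed.

Variable (R : comNzRingType).
Local Notation P := {mpoly R[n]}.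

(** Transpositions inside the two blocks generate the product of the symmetric groups, so symmetry
    becomes a finite list of linear conditions. *)
Definition bsym (f : P) := forall i j, block i j -> msym (tperm i j) f = f.

Lemma bsymM f g : bsym f -> bsym g -> bsym (f * g).
Proof. by move=> sf sg i j ij; rewrite rmorphM /= sf ?sg. Qed.

Lemma bsymD f g : bsym f -> bsym g -> bsym (f + g).
Proof. by move=> sf sg i j ij; rewrite rmorphD /= sf ?sg. Qed.

Lemma bsymZ c f : bsym f -> bsym (c *: f).
Proof. by move=> sf i j ij; rewrite linearZ /= sf. Qed.

Lemma bsym1 : bsym 1.
Proof. by move=> i j ij; rewrite rmorph1. Qed.

Lemma bsymX f e : bsym f -> bsym (f ^+ e).
Proof. by move=> sf i j ij; rewrite rmorphXn /= sf. Qed.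

Lemma msupp_block f i j (m : 'X_{1..n}) : bsym f -> block i j -> (m # tperm i j \in msupp f) = (m
  \in msupp f).
Proof. by move=> sf ij; rewrite !mcoeff_msupp -mcoeff_sym sf. Qed.

(** Take a monomial of [f] in [G] with [psi] maximal. If [psi] of it were not decreasing in a block,
    a transposition inside that block would increase it while staying in the support and in [G]. *)
Lemma exists_bdec (f : P) (G : pred 'X_{1..n}) (psi : 'X_{1..n} -> 'X_{1..n}) m0 :
  bsym f -> (forall i j (m : 'X_{1..n}), block i j -> G (m # tperm i j) = G m) ->
  (forall i j (m : 'X_{1..n}), block i j -> psi (m # tperm i j) = psi m # tperm i j) ->
  m0 \in msupp f -> G m0 -> exists m, [/\ m \in msupp f, G m & bdec (psi m)].
Proof.
move=> sf GE psiE m0f Gm0.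
have [m1 m1S m1P] : exists2 m1, m1 \in m0 :: filter G (msupp f) &
    forall m, m \in m0 :: filter G (msupp f) -> (psi m <= psi m1)%O.
  elim: (filter G (msupp f)) (m0) => [|x S IHS] x0.
    by exists x0; rewrite ?mem_seq1 // => j; rewrite mem_seq1 => /eqP ->.
  have [m1 m1S m1P] := IHS x.
  have [le|lt] := Order.TotalTheory.leP (psi x0) (psi m1).
    exists m1; first by rewrite in_cons m1S orbT.
    by move=> m; rewrite in_cons => /orP[/eqP ->|/m1P].
  exists x0; first by rewrite mem_head.
  move=> m; rewrite in_cons => /orP[/eqP ->|/m1P] //.
  by move=> /Order.POrderTheory.le_trans; apply; apply: Order.POrderTheory.ltW.
have [m1f Gm1] : m1 \in msupp f /\ G m1.
  by move: m1S; rewrite in_cons mem_filter => /orP[/eqP ->|/andP[]].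
exists m1; split=> //; case: (bdecP (psi m1)) => // /not_bdec[i [j [ij]]].
rewrite -psiE // Order.POrderTheory.lt_neqAle andbC.
rewrite Order.POrderTheory.le_eqVlt => /andP[/orP[/eqP->|lt]]; first by rewrite eqxx.
have : (psi (m1 # tperm i j) <= psi m1)%O.
  by apply: m1P; rewrite in_cons mem_filter GE // Gm1 msupp_block // m1f orbT.
by rewrite Order.TotalTheory.leNgt lt.
Qed.

Lemma bdec_mlead (f : P) : bsym f -> f != 0 -> bdec (mlead f).
Proof.
move=> sf f0; case: (bdecP (mlead f)) => // /not_bdec[i [j [ij]]].
have : mlead f # tperm i j \in msupp f by rewrite msupp_block // mlead_supp.
by move/msupp_le_mlead; rewrite Order.TotalTheory.leNgt => /negbTE ->.
Qed.

End Blocks.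

(** * Orbit sums and their leading monomials *)

Section Orbits.
Variables (F : fieldType) (r s : nat).
Local Notation P := {mpoly F[r + s]}.
Local Notation yvar := (@yvar F r s).
Local Notation zvar := (@zvar F r s).

Lemma augm_yvarE u : augm yvar u = \sum_(p : 'S_r) 'X_[bmnm (fun a => u (p a)) (fun=> 0%N)].
Proof.
rewrite augm_perm; apply: eq_bigr => p _; rewrite [in RHS]mpolyXE_id big_split_ord /=.
rewrite [X in _ * X]big1 ?mulr1 => [|b _]; last by rewrite bmnm_r expr0.
by apply: eq_bigr => a _; rewrite bmnm_l.
Qed.

Lemma augm_zvarE v : augm zvar v = \sum_(p : 'S_s) 'X_[bmnm (fun=> 0%N) (fun b => v (p b))].
Proof.
rewrite augm_perm; apply: eq_bigr => p _; rewrite [in RHS]mpolyXE_id big_split_ord /=.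
rewrite [X in X * _]big1 ?mul1r => [|b _]; last by rewrite bmnm_l expr0.
by apply: eq_bigr => a _; rewrite bmnm_r.
Qed.

Lemma bsym_augm_yvar (u : 'I_r -> nat) : bsym (augm yvar u).
Proof.
move=> i j /blockP[[a [b [-> ->]]]|[a [b [-> ->]]]]; rewrite augm_yvarE raddf_sum /=.
  rewrite [RHS](reindex_inj (mulgI (tperm a b))); apply: eq_bigr => p _ /=.
  rewrite msymX tpermV bmnm_tperm_l; congr 'X_[_].
  by apply: eq_bmnm => // c; rewrite permM.
by apply: eq_bigr => p _; rewrite msymX tpermV bmnm_tperm_r.
Qed.

Lemma bsym_augm_zvar (v : 'I_s -> nat) : bsym (augm zvar v).
Proof.
move=> i j /blockP[[a [b [-> ->]]]|[a [b [-> ->]]]]; rewrite augm_zvarE raddf_sum /=.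
  by apply: eq_bigr => p _; rewrite msymX tpermV bmnm_tperm_l.
rewrite [RHS](reindex_inj (mulgI (tperm a b))); apply: eq_bigr => p _ /=.
rewrite msymX tpermV bmnm_tperm_r; congr 'X_[_].
by apply: eq_bmnm => // c; rewrite permM.
Qed.

Hypothesis charF : [pchar F] =i pred0.

Lemma sum_nat_neq0 (I : finType) (Q : pred I) i : Q i -> \sum_i (Q i)%:R != 0 :> F.
Proof.
by move=> Qi; rewrite -natr_sum char0_natr_neq0 // (bigD1 i) //= Qi.
Qed.

(** The leading monomial is decreasing in the block and is a rearrangement of [u], so it is [u]
    itself. Characteristic 0 keeps the coefficient, a stabilizer order, nonzero. *)
Lemma mlead_augm_yvar (u : 'I_r -> nat) : nonincr u ->
  augm yvar u != 0 /\ mlead (augm yvar u) = bmnm u (fun=> 0%N).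
Proof.
move=> du; have f0 : augm yvar u != 0.
  apply/eqP => /(congr1 (mcoeff (bmnm u (fun=> 0%N)))); apply/eqP.
  rewrite augm_yvarE raddf_sum mcoeff0 /=.
  under eq_bigr do rewrite mcoeffX; apply: (sum_nat_neq0 (i := 1%g)).
  by apply/eqP; apply: eq_bmnm => // a; rewrite perm1.
split=> //; have [dl _] := bdec_mlead (bsym_augm_yvar u) f0.
have := mlead_supp f0; rewrite {2}augm_yvarE => /msupp_sum_le /flatten_mapP[p _] /=;
  rewrite msuppX mem_seq1 => /eqP mE.
move: dl; rewrite mE => dl; apply: eq_bmnm => // a; apply: nonincr_perm => // i j ij.
by have := dl i j ij; rewrite !bmnm_l.
Qed.

Lemma mlead_augm_zvar (v : 'I_s -> nat) : nonincr v ->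
  augm zvar v != 0 /\ mlead (augm zvar v) = bmnm (fun=> 0%N) v.
Proof.
move=> dv; have f0 : augm zvar v != 0.
  apply/eqP => /(congr1 (mcoeff (bmnm (fun=> 0%N) v))); apply/eqP.
  rewrite augm_zvarE raddf_sum mcoeff0 /=.
  under eq_bigr do rewrite mcoeffX; apply: (sum_nat_neq0 (i := 1%g)).
  by apply/eqP; apply: eq_bmnm => // a; rewrite perm1.
split=> //; have [_ dl] := bdec_mlead (bsym_augm_zvar v) f0.
have := mlead_supp f0; rewrite {2}augm_zvarE => /msupp_sum_le /flatten_mapP[p _] /=;
  rewrite msuppX mem_seq1 => /eqP mE.
move: dl; rewrite mE => dl; apply: eq_bmnm => // a; apply: nonincr_perm => // i j ij.
by have := dl i j ij; rewrite !bmnm_r.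
Qed.

End Orbits.

(** * The fibre a = 0, z = 0 *)

Lemma cumD l (d d' : 'I_l -> nat) a : cum (fun b => (d b + d' b)%N) a = (cum d a + cum d' a)%N.
Proof. by rewrite /cum big_split. Qed.

Lemma cumZ l k (d : 'I_l -> nat) a : cum (fun b => (k * d b)%N) a = (k * cum d a)%N.
Proof. by rewrite /cum big_distrr. Qed.

(** The size of a diagram, counted by rows and by columns. *)
Lemma sum_cum l (d : 'I_l -> nat) : (\sum_a cum d a = \sum_b d b * b.+1)%N.
Proof.
rewrite /cum; under eq_bigr do rewrite big_mkcond; rewrite exchange_big /=.
apply: eq_bigr => b _; rewrite -big_mkcond sum_nat_const mulnC; congr (_ * _)%N.
rewrite -sum1_card -(big_ord_widen_cond l (fun=> true) (fun=> 1%N) (ltn_ord b)) /=.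
by rewrite sum_nat_const card_ord muln1.
Qed.

Section Fibre.
Variables (F : fieldType) (r s : nat).
Local Notation n := (r + s)%N.
Local Notation P := {mpoly F[n]}.
Local Notation l := (@lshift r s).
Local Notation rr := (@rshift r s).
Local Notation k := s.+1.
Local Notation yvar := (@yvar F r s).
Local Notation zvar := (@zvar F r s).
Local Notation box := {ffun 'I_r -> 'I_s.+1}.

(** Partitions in which every column height occurs at most s times; there are (s+1)^r of them. *)
Definition part (B : box) : 'I_r -> nat := cum (fun a => B a : nat).

Definition theta_deg (i : 'I_n) : nat :=
  match split i with inl a => k * a.+1 | inr b => b.+1 end.

(** Up to nonzero factorial multiples, the elementary symmetric polynomials in the y_i^(s+1) and
    those in the z_j. *)
Definition theta0 (i : 'I_n) : P :=
  match split i with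
  | inl a => augm yvar (fun c : 'I_r => k * (c <= a))%N
  | inr b => augm zvar (fun c : 'I_s => (c <= b)%N : nat)
  end.

Lemma theta0_l a : theta0 (l a) = augm yvar (fun c : 'I_r => k * (c <= a))%N.
Proof. by rewrite /theta0 -[lshift s a]/(unsplit (inl a)) unsplitK. Qed.

Lemma theta0_r b : theta0 (rr b) = augm zvar (fun c : 'I_s => (c <= b)%N : nat).
Proof. by rewrite /theta0 -[rshift r b]/(unsplit (inr b)) unsplitK. Qed.

Lemma theta_deg_l a : theta_deg (l a) = (k * a.+1)%N.
Proof. by rewrite /theta_deg -[lshift s a]/(unsplit (inl a)) unsplitK. Qed.

Lemma theta_deg_r b : theta_deg (rr b) = b.+1.
Proof. by rewrite /theta_deg -[rshift r b]/(unsplit (inr b)) unsplitK. Qed.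

Lemma theta_deg_gt0 i : (0 < theta_deg i)%N.
Proof. by case: (split_ordP i) => [a|b] ->; rewrite ?theta_deg_l ?theta_deg_r. Qed.

(** The leading monomial of theta^e eta_B before relabelling: [e] counts groups of s+1 equal columns
    in y and [B] the columns left over. Euclidean division by s+1 makes this a bijection onto the
    monomials decreasing in each block. *)
Definition lmon (e : 'X_{1..n}) (B : box) : 'X_{1..n} :=
  bmnm (cum (fun a => k * e (l a) + B a)%N) (cum (fun b => e (rr b))).

Lemma lmon_inj e B e' B' : lmon e B = lmon e' B' -> e = e' /\ B = B'.
Proof.
move=> E.
have El a : (k * e (l a) + B a = k * e' (l a) + B' a)%N.
  rewrite -(dif_cum (fun a => k * e (l a) + B a)%N).
  rewrite -(dif_cum (fun a => k * e' (l a) + B' a)%N).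
  rewrite /dif /succ_val.
  have Ec c : cum (fun a => k * e (l a) + B a)%N c = cum (fun a => k * e' (l a) + B' a)%N c.
    by have /mnmP/(_ (l c)) := E; rewrite !bmnm_l.
  by rewrite Ec; case: insubP => // c _ _; rewrite Ec.
have Er b : e (rr b) = e' (rr b).
  rewrite -(dif_cum (fun b => e (rr b))) -(dif_cum (fun b => e' (rr b))).
  rewrite /dif /succ_val; have Ec c : cum (fun b => e (rr b)) c = cum (fun b => e' (rr b)) c.
    by have /mnmP/(_ (rr c)) := E; rewrite !bmnm_r.
  by rewrite Ec; case: insubP => // c _ _; rewrite Ec.
have EB a : B a = B' a.
  apply: val_inj; have := congr1 (modn^~ k) (El a).
  by rewrite /= ![(k * _)%N]mulnC !modnMDl !modn_small.
split; last exact/ffunP.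
apply: bmnmP => // a; have := El a; rewrite EB => /addIn/eqP.
by rewrite eqn_pmul2l // => /eqP.
Qed.

Lemma lmon_surj m : bdec m -> exists e B, m = lmon e B.
Proof.
move=> [dl dr].
exists (bmnm (fun a => dif (fun c => m (l c)) a %/ k)%N (dif (fun c => m (rr c)))).
exists [ffun a => inord (dif (fun c => m (l c)) a %% k)%N].
rewrite {1}(bmnm_id m); apply: eq_bmnm => a.
  rewrite -(cum_dif dl); apply: eq_bigr => c _.
  by rewrite bmnm_l ffunE inordK ?ltn_pmod // mulnC -divn_eq.
by rewrite -(cum_dif dr); apply: eq_bigr => c _; rewrite bmnm_r.
Qed.

(* For b = true the image of phi consists of 0 and of all c >= s+1, and phi commutes with the
   addition of multiples of s+1. *)
Definition phi (b : bool) (c : nat) : nat := if b && ~~ (k %| c)%N then (c + k)%N else c.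
Definition psi (b : bool) (c : nat) : nat := if b && ~~ (k %| c)%N then (c - k)%N else c.

Lemma phiD b q c : phi b (k * q + c)%N = (k * q + phi b c)%N.
Proof. by rewrite /phi dvdn_addr ?dvdn_mulr //; case: ifP => // _; rewrite addnA. Qed.

Lemma phi_inj b : injective (phi b).
Proof.
case: b => // c d; rewrite /phi /=.
case: (boolP (k %| c)%N) => kc; case: (boolP (k %| d)%N) => kd //= E.
- by move: kc kd; rewrite E dvdn_addl ?dvdnn // => ->.
- by move: kd kc; rewrite -E dvdn_addl ?dvdnn // => ->.
- exact: addIn E.
Qed.

Lemma psiK c : (c = 0 \/ s < c)%N -> phi true (psi true c) = c.
Proof.
rewrite /phi /psi /=; case: (boolP (k %| c)%N) => [->//|kc] /= [c0|sc];
  first by rewrite c0 dvdn0 in kc.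
by rewrite dvdn_subl // ?dvdnn // (negPf kc) /= subnK.
Qed.

Lemma phi_true c : phi true c = 0%N \/ (s < phi true c)%N.
Proof.
rewrite /phi /=; case: (boolP (k %| c)%N) => /= [|_]; last by right; lia.
by move=> /dvdnP[[|q] ->]; [left|right]; lia.
Qed.

Definition phim b (m : 'X_{1..n}) := bmnm (fun a => phi b (m (l a))) (fun c => m (rr c)).
Definition psim b (m : 'X_{1..n}) := bmnm (fun a => psi b (m (l a))) (fun c => m (rr c)).

Definition eta0 b (B : box) : P := augm yvar (fun a => phi b (part B a)).
Definition tmon (e : 'X_{1..n}) : P := \prod_i theta0 i ^+ e i.

Lemma phim_inj b : injective (phim b).
Proof.
move=> m m' /mnmP E; apply: bmnmP => a.
  by have := E (l a); rewrite !bmnm_l => /phi_inj.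
by have := E (rr a); rewrite !bmnm_r.
Qed.

Lemma mdeg_bmnm u v : mdeg (bmnm u v : 'X_{1..n}) = (\sum_a u a + \sum_b v b)%N.
Proof.
by rewrite mdegE big_split_ord /=; congr addn; apply: eq_bigr => a _; rewrite ?bmnm_l ?bmnm_r.
Qed.

Definition wdeg (e : 'X_{1..n}) : nat := (\sum_i e i * theta_deg i)%N.
Definition eta_deg b (B : box) : nat := (\sum_a phi b (part B a))%N.

(** The marked monomial has the degree of theta^e eta_B, because [phi] commutes with adding
    multiples of s+1; this permits working in bounded degree. *)
Lemma mdeg_lmon b e B : mdeg (phim b (lmon e B)) = (wdeg e + eta_deg b B)%N.
Proof.
rewrite mdeg_bmnm /wdeg big_split_ord /= addnAC; congr addn; last first.
  under eq_bigr do rewrite bmnm_r; rewrite sum_cum.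
  by apply: eq_bigr => c _; rewrite theta_deg_r.
transitivity (\sum_a (k * cum (fun c => e (l c)) a + phi b (part B a)))%N.
  by apply: eq_bigr => a _; rewrite bmnm_l cumD cumZ phiD.
rewrite big_split; congr addn; rewrite -big_distrr /= sum_cum big_distrr /=.
by apply: eq_bigr => c _; rewrite theta_deg_l; lia.
Qed.

Lemma wdegD e e' : wdeg (e + e')%MM = (wdeg e + wdeg e')%N.
Proof. by rewrite /wdeg -big_split; apply: eq_bigr => i _; rewrite mnmDE mulnDl. Qed.

Lemma wdeg1 i : wdeg U_(i)%MM = theta_deg i.
Proof.
rewrite /wdeg (bigD1 i) //= mnm1E eqxx mul1n big1 ?addn0 // => j ji.
by rewrite mnm1E eq_sym (negPf ji).
Qed.

Lemma leq_wdeg e : (mdeg e <= wdeg e)%N.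
Proof. by rewrite mdegE; apply: leq_sum => i _; rewrite leq_pmulr ?theta_deg_gt0. Qed.

Hypothesis charF : [pchar F] =i pred0.

Lemma mlead_theta0 i : theta0 i != 0 /\
  mlead (theta0 i) = (lmon U_(i) [ffun=> ord0])%MM.
Proof.
have le_nonincr (a m : nat) : nonincr (fun c : 'I_m => (c <= a)%N : nat).
  by move=> c d cd; case: (leqP d a) => // /(leq_trans cd) ->.
have cumU m (a : 'I_m) c : cum (fun b : 'I_m => (a == b) : nat) c = (c <= a)%N.
  rewrite /cum (big_mkcond (fun b : 'I_m => (c <= b)%N)) (bigD1 a) //= eqxx.
  by rewrite big1 ?addn0 => [|b /negPf ba]; [case: leqP|rewrite eq_sym ba; case: leqP].
case: (split_ordP i) => [a|a] ->.
  rewrite theta0_l; have [|-> ->] := @mlead_augm_yvar F r s charF (fun c : 'I_r => k * (c <= a))%N.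
    by move=> c d cd; rewrite leq_mul2l; apply/orP; right; apply: le_nonincr.
  split=> //; apply: eq_bmnm => c.
    rewrite -cumU -cumZ; apply: eq_bigr => b _.
    by rewrite ffunE addn0 mnm1E eq_lshift.
  by rewrite /cum big1 // => b _; rewrite mnm1E eq_lrshift.
rewrite theta0_r; have [|-> ->] := @mlead_augm_zvar F r s charF (fun c : 'I_s => (c <= a)%N : nat).
  exact: le_nonincr.
split=> //; apply: eq_bmnm => c.
  by rewrite /cum big1 // => b _; rewrite ffunE addn0 mnm1E eq_rlshift muln0.
by rewrite -cumU; apply: eq_bigr => b _; rewrite mnm1E eq_rshift.
Qed.

Lemma lmonD e e' B : lmon (e + e')%MM B = (lmon e [ffun=> ord0] + lmon e' B)%MM.
Proof.
apply: bmnmP => a; rewrite mnmDE ?bmnm_l ?bmnm_r -cumD; apply: eq_bigr => c _.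
  by rewrite ffunE mnmDE addn0 mulnDr addnA.
by rewrite mnmDE.
Qed.

Lemma lmon0 : lmon 0%MM [ffun=> ord0] = 0%MM.
Proof.
by apply: bmnmP => a; rewrite ?bmnm_l ?bmnm_r mnm0E /cum big1 // => c _;
  rewrite mnm0E ?ffunE ?muln0.
Qed.

Lemma mlead_tmon e : tmon e != 0 /\ mlead (tmon e) = lmon e [ffun=> ord0].
Proof.
have t0 : tmon e != 0.
  by apply/prodf_neq0 => i _; rewrite expf_neq0 //; have [] := mlead_theta0 i.
split=> //; rewrite /tmon mlead_prod; last first.
  by move=> i _ _; rewrite expf_neq0 //; have [] := mlead_theta0 i.
rewrite [in RHS](multinomUE_id e).
rewrite (big_morph (fun e => lmon e [ffun=> ord0]) (fun e e' => lmonD e e' _) lmon0).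
apply: eq_bigr => i _; have [ti tE] := mlead_theta0 i; rewrite mleadX // tE.
elim: (e i) => [|q IHq]; first by rewrite !mulm0n lmon0.
by rewrite !mulmS lmonD IHq.
Qed.

Lemma part_nonincr B : nonincr (part B).
Proof. exact: cum_nonincr. Qed.

Lemma mlead_tmon_eta0 e B : tmon e * eta0 false B != 0 /\
  mlead (tmon e * eta0 false B) = lmon e B.
Proof.
have [t0 tE] := mlead_tmon e.
have [h0 hE] := @mlead_augm_yvar F r s charF _ (@part_nonincr B).
split; first by rewrite mulf_neq0.
rewrite mleadM // tE hE; apply: bmnmP => a; rewrite mnmDE ?bmnm_l ?bmnm_r ?addn0 //.
by rewrite -cumD; apply: eq_bigr => c _; rewrite ffunE addn0.
Qed.

Definition ymult (f : P) := forall m, m \in msupp f -> forall a, (k %| m (l a))%N.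

Lemma ymultM f g : ymult f -> ymult g -> ymult (f * g).
Proof.
move=> fk gk m /msuppM_le /allpairsP[[m1 m2] /= [m1f m2g ->]] a.
rewrite mnmDE; apply: dvdn_add; [exact: fk|exact: gk].
Qed.

Lemma ymult1 : ymult 1.
Proof. by move=> m; rewrite msupp1 mem_seq1 => /eqP -> a; rewrite mnm0E dvdn0. Qed.

Lemma ymult_tmon e : ymult (tmon e).
Proof.
apply: (big_ind ymult) => [||i _]; [exact: ymult1|exact: ymultM|].
elim: (e i) => [|q IHq]; first exact: ymult1.
rewrite exprS; apply: ymultM IHq; case: (split_ordP i) => a ->{i}.
  rewrite theta0_l augm_yvarE => m /msupp_sum_le /flatten_mapP[p _] /=.
  by rewrite msuppX mem_seq1 => /eqP -> c; rewrite bmnm_l dvdn_mulr.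
rewrite theta0_r augm_zvarE => m /msupp_sum_le /flatten_mapP[p _] /=.
by rewrite msuppX mem_seq1 => /eqP -> c; rewrite bmnm_l dvdn0.
Qed.

(** Relabelling the y-exponents by [phi] commutes with multiplication by polynomials whose
    y-exponents are multiples of s+1; in particular it is linear over polynomials in the thetas. *)
Lemma mcoeff_ymult b (f : P) (u : 'I_r -> nat) m : ymult f ->
  (f * augm yvar (fun a => phi b (u a)))@_(phim b m) = (f * augm yvar u)@_m.
Proof.
move=> fk; rewrite !augm_yvarE !mulr_sumr !raddf_sum; apply: eq_bigr => p _ /=.
rewrite (mpolyE f) !mulr_suml !raddf_sum !big_seq; apply: eq_bigr => q qf /=.
rewrite -!scalerAl !mcoeffZ -!mpolyXD !mcoeffX; congr (_ * (_ : bool)%:R).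
rewrite -[in RHS](inj_eq (@phim_inj b)); congr (_ == _); apply: bmnmP => a;
  rewrite mnmDE ?bmnm_l ?bmnm_r ?mnmDE ?bmnm_l ?bmnm_r //.
by have /dvdnP[c ->] := fk q qf a; rewrite mulnC phiD.
Qed.

(** Without relabelling the leading monomials are distinct. A relation between the relabelled
    products, read at the relabelled monomials, is a relation between the original ones. *)
Lemma lin_indep_fibre b (J : finType) (x : J -> 'X_{1..n} * box) :
  injective x -> lin_indep (fun j => tmon (x j).1 * eta0 b (x j).2).
Proof.
move=> ix; have iv : lin_indep (fun j => tmon (x j).1 * eta0 false (x j).2).
  apply: lin_indep_lead => j; first by have [] := mlead_tmon_eta0 (x j).1 (x j).2.
  move=> j'; have [_ ->] := mlead_tmon_eta0 (x j).1 (x j).2.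
  have [_ ->] := mlead_tmon_eta0 (x j').1 (x j').2 => /lmon_inj[E1 E2].
  by apply: ix; rewrite (surjective_pairing (x j)) E1 E2 -surjective_pairing.
move=> c cv; apply: iv; apply/mpolyP => m.
have /(congr1 (mcoeff (phim b m))) := cv; rewrite !raddf_sum !mcoeff0 => E.
rewrite -[RHS]E; apply: eq_bigr => j _; rewrite /= !mcoeffZ; congr (_ * _).
by rewrite [RHS](mcoeff_ymult b _ m (@ymult_tmon _)).
Qed.

(** The substitution of T z for z. The variable of [{poly P}] is here the grading variable T and not
    the parameter a. *)
Definition scale_z : P -> {poly P} :=
  mmap (polyC \o @mpolyC n F) (fun i => if (i < r)%N then ('X_i)%:P else ('X_i)%:P * 'X).

HB.instance Definition _ := GRing.RMorphism.copy scale_z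
  (mmap (polyC \o @mpolyC n F) (fun i => if (i < r)%N then ('X_i)%:P else ('X_i)%:P * 'X)).

Lemma scale_zC c : scale_z c%:MP = (c%:MP)%:P.
Proof. exact: mmapC. Qed.

Lemma scale_zZ c f : scale_z (c *: f) = (c%:MP)%:P * scale_z f.
Proof. by rewrite -mul_mpolyC rmorphM /= scale_zC. Qed.

Lemma scale_zX i : scale_z 'X_i = if (i < r)%N then ('X_i)%:P else ('X_i)%:P * 'X.
Proof. by rewrite /scale_z mmapX mmap1U. Qed.

Lemma scale_z0 f : (scale_z f)`_0 = kill_z f.
Proof.
rewrite -[LHS]/((coefp 0 \o scale_z) f).
apply: (mpoly_rmorph_ext (f := coefp 0 \o scale_z) (g := @kill_z F r s)) => [c|i] /=.
  by rewrite scale_zC coefC /kill_z msubstC.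
rewrite scale_zX /kill_z msubstX; case: ifP => _; first by rewrite coefC.
by rewrite coef0M coefX mulr0.
Qed.

Lemma scale_z_augm (v : 'I_s -> nat) : scale_z (augm zvar v) = (augm zvar v)%:P * 'X^(\sum_b v b).
Proof.
rewrite /augm !raddf_sum /= mulr_suml; apply: eq_bigr => t _.
rewrite -prodrXr !rmorph_prod -big_split; apply: eq_bigr => b _ /=.
by rewrite !rmorphXn /= scale_zX /= ltnNge leq_addr exprMn.
Qed.

(* Setting T = 0 in f(y, T z) isolates the terms of least weight in z. *)
Lemma lin_indep_kill_z (J : finType) (A u : J -> P) (wt : J -> nat) :
  (forall j, scale_z (A j) = (A j)%:P * 'X^(wt j)) ->
  lin_indep (fun j => A j * kill_z (u j)) -> lin_indep (fun j => A j * u j).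
Proof.
move=> AE iv c cv; have IH m : forall j, wt j = m -> c j = 0.
  elim/ltn_ind: m => m IHm.
  (* In the coefficient of T^m, terms of smaller weight vanish by induction, larger weights do not
     occur, and weight m leaves [A j * kill_z (u j)]. *)
  pose d j := if wt j == m then c j else 0.
  suff d0 : forall j, d j = 0 by move=> j jm; have := d0 j; rewrite /d jm eqxx.
  apply: iv; have /(congr1 scale_z)/(congr1 (fun f : {poly P} => f`_m)) := cv.
  rewrite rmorph0 coef0 => E; rewrite -[RHS]E raddf_sum coef_sum; apply: eq_bigr => j _ /=.
  rewrite scale_zZ rmorphM /= AE -!mulrA coefCM mul_mpolyC coefCM coefXnM /d;
    have [jm|jm|<-] := ltngtP (wt j) m.
  - by rewrite (IHm _ jm) // !scale0r.
  - by rewrite scale0r mulr0 scaler0.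
  - by rewrite subnn scale_z0.
by move=> j; apply: IH.
Qed.

End Fibre.

(** * Quasi-invariants *)

Section QuasiInvariants.
Variables (F : fieldType) (r s : nat).
Local Notation n := (r + s)%N.
Local Notation P := {mpoly F[n]}.
Local Notation l := (@lshift r s).
Local Notation rr := (@rshift r s).
Local Notation yvar := (@yvar F r s).
Local Notation zvar := (@zvar F r s).

Definition glue i j : P -> P := msubst (fun q => if q == l i then zvar j else 'X_q).
HB.instance Definition _ i j :=
  GRing.LRMorphism.copy (glue i j) (msubst (fun q => if q == l i then zvar j else 'X_q)).

Lemma glue_zvar i j j' : glue i j (zvar j') = zvar j'.
Proof. by rewrite /glue msubstX eq_rlshift. Qed.

Lemma glue_yvar i j : glue i j (yvar i) = zvar j.
Proof. by rewrite /glue msubstX eqxx. Qed.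

(* For b = false only the symmetry is required; this runs the polynomials symmetric in y and in z
   in parallel with the quasi-invariants. *)
Definition quasi_inv (b : bool) (a : F) (f : P) :=
  bsym f /\ (b -> forall i j, glue i j f^`M(l i) = a *: glue i j f^`M(rr j)).

Lemma quasi_inv1 b a : quasi_inv b a 1.
Proof.
split; first exact: bsym1.
by move=> _ i j; rewrite -mpolyC1 !mderivC !rmorph0 scaler0.
Qed.

Lemma quasi_invM b a f g : quasi_inv b a f -> quasi_inv b a g -> quasi_inv b a (f * g).
Proof.
move=> [sf qf] [sg qg]; split; first exact: bsymM.
move=> hb i j; rewrite !mderivM !rmorphD !rmorphM /= qf // qg //.
by rewrite scalerDr -scalerAl -scalerAr.
Qed.

Lemma quasi_invD b a f g : quasi_inv b a f -> quasi_inv b a g -> quasi_inv b a (f + g).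
Proof.
move=> [sf qf] [sg qg]; split; first exact: bsymD.
by move=> hb i j; rewrite !mderivD !rmorphD /= qf // qg // scalerDr.
Qed.

Lemma quasi_invZ b a c f : quasi_inv b a f -> quasi_inv b a (c *: f).
Proof.
move=> [sf qf]; split; first exact: bsymZ.
by move=> hb i j; rewrite !mderivZ !linearZ /= qf // !scalerA mulrC.
Qed.

Lemma quasi_invX b a f e : quasi_inv b a f -> quasi_inv b a (f ^+ e).
Proof.
by move=> qf; elim: e => [|e IHe]; [apply: quasi_inv1|rewrite exprS; apply: quasi_invM].
Qed.

Lemma quasi_inv0 b a : quasi_inv b a 0.
Proof. by rewrite -(scale0r 1); apply: quasi_invZ; apply: quasi_inv1. Qed.

Lemma mderivXn i (f : P) e : (f ^+ e.+1)^`M(i) = e.+1%:R * f ^+ e * f^`M(i).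
Proof.
elim: e => [|e IHe]; first by rewrite expr1 expr0 !mul1r.
by rewrite exprS mderivM IHe exprS -[in RHS]natr1; ring.
Qed.

Lemma mderiv_var (i j : 'I_n) : ('X_j : P)^`M(i) = (i == j)%:R.
Proof.
rewrite mderivX mnm1E eq_sym; case: eqP => [->|_]; last by rewrite scale0r.
rewrite scale1r (_ : (U_(j) - U_(j))%MM = 0%MM) ?mpolyX0 //.
by apply/mnmP => q; rewrite mnmBE subnn mnm0E.
Qed.

Lemma mderiv_psum_yvar i c : (psum yvar c.+1)^`M(l i) = c.+1%:R * yvar i ^+ c.
Proof.
rewrite /psum raddf_sum (bigD1 i) //= big1 => [|j ji].
  by rewrite mderivXn mderiv_var eqxx mulr1 addr0.
by rewrite mderivXn mderiv_var eq_lshift eq_sym (negPf ji) mulr0.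
Qed.

Lemma mderiv_psum_zvar i c : (psum zvar c.+1)^`M(rr i) = c.+1%:R * zvar i ^+ c.
Proof.
rewrite /psum raddf_sum (bigD1 i) //= big1 => [|j ji].
  by rewrite mderivXn mderiv_var eqxx mulr1 addr0.
by rewrite mderivXn mderiv_var eq_rshift eq_sym (negPf ji) mulr0.
Qed.

Lemma mderiv_psum_yz i c : (psum yvar c.+1)^`M(rr i) = 0.
Proof.
by rewrite /psum raddf_sum big1 // => j _; rewrite /= mderivXn mderiv_var eq_rlshift mulr0.
Qed.

Lemma mderiv_psum_zy i c : (psum zvar c.+1)^`M(l i) = 0.
Proof.
by rewrite /psum raddf_sum big1 // => j _; rewrite /= mderivXn mderiv_var eq_lrshift mulr0.
Qed.

Lemma msym_var (p : 'S_n) i : msym p ('X_i : P) = 'X_(p i).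
Proof.
rewrite msymX; congr 'X_[_]; apply/mnmP => j; rewrite mnmE !mnm1E.
by rewrite -(inj_eq (@perm_inj _ p)) permKV.
Qed.

Lemma bsym_psum_yvar c : bsym (psum yvar c).
Proof.
move=> i j /blockP[[a [b [-> ->]]]|[a [b [-> ->]]]]; rewrite /psum raddf_sum /=.
  rewrite [RHS](reindex_inj (@perm_inj _ (tperm a b))); apply: eq_bigr => q _.
  by rewrite rmorphXn /= msym_var tperm_ll.
by apply: eq_bigr => q _; rewrite rmorphXn /= msym_var tperm_rl.
Qed.

Lemma bsym_psum_zvar c : bsym (psum zvar c).
Proof.
move=> i j /blockP[[a [b [-> ->]]]|[a [b [-> ->]]]]; rewrite /psum raddf_sum /=.
  by apply: eq_bigr => q _; rewrite rmorphXn /= msym_var tperm_lr.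
rewrite [RHS](reindex_inj (@perm_inj _ (tperm a b))); apply: eq_bigr => q _.
by rewrite rmorphXn /= msym_var tperm_rr.
Qed.

Lemma quasi_inv_newton b a c : quasi_inv b a (newton r s a c.+1).
Proof.
split; first by apply: bsymD (bsym_psum_zvar _); apply: bsymZ; apply: bsym_psum_yvar.
move=> _ i j; rewrite /newton !mderivD !mderivZ mderiv_psum_yvar mderiv_psum_zy.
rewrite mderiv_psum_yz mderiv_psum_zvar scaler0 addr0 add0r linearZ /=; congr (_ *: _).
by rewrite !rmorphM !rmorph_nat !rmorphXn /= glue_yvar glue_zvar.
Qed.

Lemma newton_alg_quasi_inv b a f : newton_alg a f -> quasi_inv b a f.
Proof.
move=> [m [q ->]]; rewrite (mpolyE q) raddf_sum.
apply: big_ind => [||e _] /=; [exact: quasi_inv0|exact: quasi_invD|].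
rewrite linearZ; apply: quasi_invZ; rewrite mpolyXE_id rmorph_prod.
apply: big_ind => [||i _]; [exact: quasi_inv1|exact: quasi_invM|].
by rewrite rmorphXn /= msubstX; apply: quasi_invX; apply: quasi_inv_newton.
Qed.

(** The polynomial delta of the overview, a product across the two blocks that vanishes on every
    hyperplane y_i = z_j. *)
Definition vander : P := \prod_(i < r) \prod_(j < s) (yvar i - zvar j).

Lemma bsym_vander : bsym vander.
Proof.
move=> i j /blockP[[a [b [-> ->]]]|[a [b [-> ->]]]]; rewrite /vander rmorph_prod /=.
  rewrite [RHS](reindex_inj (@perm_inj _ (tperm a b))); apply: eq_bigr => q _.
  rewrite rmorph_prod; apply: eq_bigr => q' _.
  by rewrite rmorphB /= !msym_var tperm_ll tperm_lr.
apply: eq_bigr => q _; rewrite rmorph_prod /=.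
rewrite [RHS](reindex_inj (@perm_inj _ (tperm a b))); apply: eq_bigr => q' _.
by rewrite rmorphB /= !msym_var tperm_rl tperm_rr.
Qed.

Lemma vander_neq0 : vander != 0.
Proof.
apply/prodf_neq0 => i _; apply/prodf_neq0 => j _.
rewrite subr_eq0; apply/eqP => /(congr1 (mcoeff U_(l i))); apply/eqP.
by rewrite !mcoeffXU eqxx eq_rlshift oner_neq0.
Qed.

Lemma glue_vander i j : glue i j vander = 0.
Proof.
rewrite /vander (bigD1 i) // (bigD1 j) //= !rmorphM /= rmorphB /= glue_yvar glue_zvar.
by rewrite subrr !mul0r.
Qed.

(** Every first derivative of a multiple of delta^2 keeps a factor delta, so both sides of the
    condition restrict to 0. *)
Lemma quasi_inv_vander b a f : bsym f -> quasi_inv b a (vander ^+ 2 * f).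
Proof.
move=> sf; split; first by apply: bsymM sf; apply: bsymX; apply: bsym_vander.
by move=> _ i j; rewrite expr2 !mderivM !(rmorphD, rmorphM) /= !glue_vander !(mul0r, mulr0, addr0)
  scaler0.
Qed.

(** Indexes the conditions for quasi-invariance. Each is written as a part free of a plus a times
    another linear map, the shape that [generic_span] expects. *)
Definition qcond : finType := ('I_n * 'I_n + 'I_r * 'I_s)%type.

Definition qcond0 b (c : qcond) (f : P) : P :=
  match c with
  | inl (i, j) => if block i j then msym (tperm i j) f - f else 0
  | inr (i, j) => if b then glue i j f^`M(l i) else 0
  end.

Definition qcond1 b (c : qcond) (f : P) : P :=
  match c with
  | inl _ => 0
  | inr (i, j) => if b then - glue i j f^`M(rr j) else 0
  end.

Lemma qcond0_linear b c : linear (qcond0 b c).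
Proof.
case: c => [[i j]|[i j]] x f g /=; case: ifP => _; rewrite ?scaler0 ?addr0 //.
  by rewrite linearP /= scalerBr opprD addrACA.
by rewrite mderivD mderivZ linearP.
Qed.

Lemma qcond1_linear b c : linear (qcond1 b c).
Proof.
case: c => [[i j]|[i j]] x f g /=; rewrite ?scaler0 ?addr0 //.
case: ifP => _; rewrite ?scaler0 ?addr0 //.
by rewrite mderivD mderivZ linearP opprD scalerN.
Qed.

Lemma quasi_invP b a f :
  quasi_inv b a f <-> forall c, qcond0 b c f + a *: qcond1 b c f = 0.
Proof.
split=> [[sf qf] [[i j]|[i j]] /=|H].
- by case: ifP => ij; rewrite ?sf // ?subrr scaler0 addr0.
- by case: b qf => qf; rewrite ?scaler0 ?addr0 // scalerN qf // subrr.
split=> [i j ij|hb i j].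
  by have := H (inl (i, j)); rewrite /= ij scaler0 addr0 => /eqP; rewrite subr_eq0 => /eqP.
by have := H (inr (i, j)); rewrite /= hb scalerN => /eqP; rewrite subr_eq0 => /eqP.
Qed.

Lemma glue_mod i j f : exists g, f = glue i j f + (yvar i - zvar j) * g.
Proof.
pose Q f := exists g, f = glue i j f + (yvar i - zvar j) * g.
apply: (mpoly_alg_ind (Q := Q)) => [c|q|f1 f2 [g1 E1] [g2 E2]|f1 f2 [g1 E1] [g2 E2]].
- by exists 0; rewrite mulr0 addr0 /glue msubstC.
- rewrite /Q /glue msubstX; case: eqP => [->|_]; last by exists 0; rewrite mulr0 addr0.
  by exists 1; rewrite mulr1 addrC subrK.
- by exists (g1 + g2); rewrite rmorphD {1}E1 {1}E2 /= mulrDr addrACA.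
- exists (g1 * glue i j f2 + glue i j f1 * g2 + (yvar i - zvar j) * g1 * g2).
  by rewrite rmorphM {1}E1 {1}E2 /=; ring.
Qed.

(** The factors y_i - z_j are split off one at a time. *)
Lemma glue_div i (f : P) : (forall j, glue i j f = 0) ->
  exists g, f = \prod_(j < s) (yvar i - zvar j) * g.
Proof.
move=> f0; suff [g fE] : exists g, f = \prod_(j <- enum 'I_s) (yvar i - zvar j) * g.
  by exists g; rewrite {1}fE big_enum.
elim: (enum 'I_s) (enum_uniq 'I_s) => [_|j q IHq /= /andP[jq uq]].
  by exists f; rewrite big_nil mul1r.
(* On y_i = z_j the factors already split off become differences of distinct z-variables, which are
   nonzero, so the cofactor vanishes there. *)
have [g fE] := IHq uq; have := f0 j; rewrite fE rmorphM rmorph_prod => /eqP.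
rewrite mulf_eq0 => /orP[|/eqP g0].
  rewrite prodf_seq_eq0 => /hasP[j' j'q]; rewrite /= rmorphB /= glue_yvar glue_zvar.
  rewrite subr_eq0 => /eqP /(congr1 (mcoeff U_(rr j))) /eqP.
  rewrite !mcoeffXU eqxx eq_rshift; have [E|_] := eqVneq j' j; first by rewrite -E j'q in jq.
  by have /negP h := oner_neq0 F => /h.
have [h gE] := glue_mod i j g; exists h; rewrite big_cons gE g0 add0r.
by rewrite mulrCA mulrA.
Qed.

Lemma mlead_yz i j : yvar i - zvar j != 0 /\ mlead (yvar i - zvar j) = U_(l i)%MM.
Proof.
have lt : (U_(rr j) < U_(l i) :> 'X_{1..n})%MM%O.
  apply/ltmcP; first by rewrite !mdeg1.
  exists (l i) => [q qi|]; last by rewrite !mnm1E eqxx eq_rlshift.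
  rewrite !mnm1E; have -> : (l i == q) = false by rewrite -val_eqE /= gtn_eqF.
  by rewrite -val_eqE /= gtn_eqF // (leq_trans qi) //= (leq_trans (ltnW (ltn_ord i))) // leq_addr.
split; last by rewrite mleadDl ?mleadN ?mleadXm.
rewrite subr_eq0; apply/eqP => /(congr1 (mcoeff U_(l i))); apply/eqP.
by rewrite !mcoeffXU eqxx eq_rlshift oner_neq0.
Qed.

Hypothesis charF : [pchar F] =i pred0.

Lemma mlead_mderiv i (f : P) : (0 < mlead f (l i))%N ->
  f^`M(l i) != 0 /\ mlead f^`M(l i) = (mlead f - U_(l i))%MM.
Proof.
move=> m0; have f0 : f != 0 by apply: contraTneq m0 => ->; rewrite mlead0 mnm0E.
have mE : (mlead f - U_(l i) + U_(l i))%MM = mlead f.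
  by apply: submK; rewrite lep1mP -lt0n.
have c0 : (f^`M(l i))@_(mlead f - U_(l i)) != 0.
  rewrite mcoeff_deriv mE -mulr_natr mulf_neq0 ?mleadc_eq0 //.
  exact: char0_natr_neq0.
have d0 : f^`M(l i) != 0 by apply: contraNneq c0 => ->; rewrite mcoeff0.
split=> //; apply: Order.POrderTheory.le_anti; apply/andP; split; last first.
  by apply: msupp_le_mlead; rewrite mcoeff_msupp.
rewrite -(lemc_add2l _ _ U_(l i)) mE; apply: msupp_le_mlead.
have := mlead_supp d0; rewrite !mcoeff_msupp mcoeff_deriv; apply: contraNneq => ->.
by rewrite mul0rn.
Qed.

(** At a = 0 the derivative in y_i vanishes on all y_i = z_j, so it is divisible by a product with
    leading monomial y_i^s. A positive exponent of y_i in the leading monomial of [f], lowered by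
    one, is therefore at least s. *)
Lemma mlead_quasi_inv0 f i : quasi_inv true 0 f -> f != 0 ->
  mlead f (l i) = 0%N \/ (s < mlead f (l i))%N.
Proof.
move=> [sf qf] f0; have [->|m0] := posnP (mlead f (l i)); [by left|right].
have [d0 dE] := mlead_mderiv m0.
have [|g gE] := @glue_div i f^`M(l i); first by move=> j; rewrite qf // scale0r.
have g0 : g != 0 by apply: contraNneq d0 => g0; rewrite gE g0 mulr0.
have p0 : \prod_(j < s) (yvar i - zvar j) != 0.
  by apply/prodf_neq0 => j _; have [] := mlead_yz i j.
have /(congr1 (fun m : 'X_{1..n} => m (l i))) := dE.
rewrite gE mleadM // mlead_prod => [|j _ _]; last by have [] := mlead_yz i j.
rewrite (eq_bigr (fun=> U_(l i)%MM)) => [|j _]; last by have [] := mlead_yz i j.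
rewrite mnmDE mnm_sumE mnmBE mnm1E eqxx sum_nat_const card_ord muln1.
by have := m0; lia.
Qed.

Lemma block_map_tperm (c : nat -> nat) (m : 'X_{1..n}) i j : block i j ->
  let h (m : 'X_{1..n}) := bmnm (fun a => c (m (l a))) (fun a => m (rr a)) in
  h [multinom m (tperm i j q) | q < n] = [multinom h m (tperm i j q) | q < n].
Proof.
move=> /blockP[[a [b [-> ->]]]|[a [b [-> ->]]]] /=.
  by rewrite bmnm_tperm_l; apply: eq_bmnm => q; rewrite mnmE ?tperm_ll ?tperm_lr.
by rewrite bmnm_tperm_r; apply: eq_bmnm => q; rewrite mnmE ?tperm_rl ?tperm_rr.
Qed.

(** Supplies the injectivity at a = 0 for [generic_span]: a nonzero solution cannot miss all marked
    monomials. *)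
Lemma mcoeff_quasi_inv0 b f : quasi_inv b 0 f -> f != 0 ->
  exists e B, phim b (lmon e B) \in msupp f.
Proof.
move=> qf f0; have [sf _] := qf.
(* [G] selects the image of [phim b]. It contains the leading monomial by [mlead_quasi_inv0], and
   maximizing the preimage under the relabelling yields a decreasing one. *)
pose G (m : 'X_{1..n}) := phim b (psim b m) == m.
have inj_tp i j : injective (fun m : 'X_{1..n} => [multinom m (tperm i j q) | q < n]).
  by move=> m m' /mnmP E; apply/mnmP => q; have := E (tperm i j q); rewrite !mnmE tpermK.
have [i j m ij|i j m ij||m [mf /eqP Gm /lmon_surj[e [B mE]]]] :=
    @exists_bdec r s F f G (psim b) (mlead f) sf _ _ (mlead_supp f0).
- have E1 : psim b [multinom m (tperm i j q) | q < n] = [multinom psim b m (tperm i j q) | q < n].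
    exact: block_map_tperm.
  have E2 (m' : 'X_{1..n}) : phim b [multinom m' (tperm i j q) | q < n] = [multinom phim b m'
    (tperm i j q) | q < n].
    exact: block_map_tperm.
  rewrite /G E1 E2.
  exact: (inj_eq (@inj_tp i j)).
- exact: block_map_tperm.
- apply/eqP; rewrite /phim /psim; case: b qf {G} => qf; last by rewrite -!bmnm_id.
  apply: bmnmP => a; rewrite ?bmnm_l ?bmnm_r // psiK //.
  exact: mlead_quasi_inv0.
- by exists e, B; rewrite -mE Gm.
Qed.

End QuasiInvariants.

(** * Generic bases in bounded degree *)

Section Families.
Variables (F : fieldType) (n : nat).
Local Notation P := {mpoly F[n]}.

Definition homog_fam (d : nat) (f : {poly P}) := forall i, f`_i \is d.-homog.

Lemma homog_famM d e f g : homog_fam d f -> homog_fam e g -> homog_fam (d + e) (f * g).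
Proof. by move=> fH gH i; rewrite coefM; apply: rpred_sum => j _; apply: dhomogM. Qed.

Lemma homog_fam1 : homog_fam 0 1.
Proof. by move=> i; rewrite coef1; case: eqP => _; rewrite ?dhomog1 ?dhomog0. Qed.

Lemma homog_famX d f e : homog_fam d f -> homog_fam (e * d) (f ^+ e).
Proof.
move=> fH; elim: e => [|e IHe]; first exact: homog_fam1.
by rewrite exprS mulSn; apply: homog_famM.
Qed.

Lemma homog_fam_prod (I : Type) (q : seq I) (f : I -> {poly P}) (d : I -> nat) :
  (forall i, homog_fam (d i) (f i)) ->
  homog_fam (\sum_(i <- q) d i) (\prod_(i <- q) f i).
Proof.
move=> fH; elim: q => [|i q IHq]; first by rewrite !big_nil; apply: homog_fam1.
by rewrite !big_cons; apply: homog_famM.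
Qed.

Lemma homog_fam_horner d f a : homog_fam d f -> f.[a%:MP] \is d.-homog.
Proof.
move=> fH; rewrite horner_coef; apply: rpred_sum => i _.
by rewrite mulrC -rmorphXn mul_mpolyC; apply: dhomogZ.
Qed.

Lemma msize_homog d (f : P) : f \is d.-homog -> (msize f <= d.+1)%N.
Proof.
move=> /dhomogP fH; rewrite msizeE; apply/bigmax_leqP_seq => m mf _.
by rewrite ltnS (fH m mf).
Qed.

Hypothesis charF : [pchar F] =i pred0.

Lemma poly_eq0_char0 (f : {poly P}) : (forall a : F, a != 0 -> f.[a%:MP] = 0) -> f = 0.
Proof.
move=> f0; apply/eqP/negPn/negP => nf.
(* As many roots as the size of [f], one more than its degree; the shift by one avoids a = 0. *)
pose q := [seq ((m.+1)%:R : F)%:MP_[n] | m <- iota 0 (size f)].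
have uq : uniq q.
  rewrite map_inj_uniq ?iota_uniq // => i j /eqP; rewrite mpolyC_eq => /eqP E.
  wlog ij : i j E / (i <= j)%N.
    by move=> H; case/orP: (leq_total i j) => ij; [apply: H|apply/esym/H].
  apply/eqP; rewrite eqn_leq ij /= leqNgt; apply/negP => lt.
  have := @char0_natr_neq0 F (j - i) charF; rewrite subn_gt0 lt natrB // -[j%:R](addrK 1)
    -[i%:R](addrK 1).
  by rewrite !natr1 E subrr eqxx => /(_ isT).
have : all (root f) q.
  by apply/allP => _ /mapP[m _ ->]; apply/eqP/f0/char0_natr_neq0.
move=> aq; have := max_poly_roots nf aq uq.
by rewrite size_map size_iota ltnn.
Qed.

(** The condition is polynomial in the parameter, so its validity at all nonzero a extends to a =
    0. *)
Lemma linear_fam_at0 (l0 l1 : P -> P) (f : {poly P}) : linear l0 -> linear l1 ->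
  (forall a, a != 0 -> l0 f.[a%:MP] + a *: l1 f.[a%:MP] = 0) -> l0 f.[0] = 0.
Proof.
move=> lin0 lin1 fa.
pose L0 : {linear P -> P} := HB.pack l0 (GRing.isLinear.Build F _ _ _ l0 lin0).
pose L1 : {linear P -> P} := HB.pack l1 (GRing.isLinear.Build F _ _ _ l1 lin1).
pose g := \poly_(i < size f) L0 f`_i + \poly_(i < size f) L1 f`_i * 'X.
have hE (L : {linear P -> P}) a : (\poly_(i < size f) L f`_i).[a%:MP] = L f.[a%:MP].
  rewrite horner_poly horner_coef raddf_sum; apply: eq_bigr => i _ /=.
  by rewrite -rmorphXn mulrC mul_mpolyC [in RHS]mulrC mul_mpolyC linearZ.
have gE a : g.[a%:MP] = l0 f.[a%:MP] + a *: l1 f.[a%:MP].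
  by rewrite /g hornerD hornerM hornerX !hE mulrC mul_mpolyC.
have g0 : g = 0 by apply: poly_eq0_char0 => a a0; rewrite gE fa.
have := gE 0; rewrite g0 horner0 scale0r addr0 mpolyC0 => /esym.
by [].
Qed.

End Families.

Lemma sum_leq_ord m (a : 'I_m) : (\sum_(c < m) (c <= a) = a.+1)%N.
Proof.
under eq_bigr => c _ do rewrite -[nat_of_bool _]muln1 mulnbl.
rewrite -big_mkcond -(big_ord_widen m (fun=> 1%N) (ltn_ord a)).
by rewrite sum_nat_const card_ord muln1.
Qed.

Section Generic.
Variables (F : fieldType) (r s : nat).
Local Notation n := (r + s)%N.
Local Notation P := {mpoly F[n]}.
Local Notation l := (@lshift r s).
Local Notation rr := (@rshift r s).
Local Notation yvar := (@yvar F r s).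
Local Notation zvar := (@zvar F r s).
Local Notation box := {ffun 'I_r -> 'I_s.+1}.
Hypothesis charF : [pchar F] =i pred0.

(** The z-thetas are attained exactly at a = 0, the y-thetas only modulo z, whence the case
    distinction. *)
Lemma theta_lift i : exists2 f, newton_fam (@theta_deg r s i) f &
  (if (i < r)%N then kill_z f`_0 else f`_0) = @theta0 F r s i.
Proof.
case: (split_ordP i) => [a|b] ->.
  have [c|f fA f0] := @augm_yvar_lift F r s charF r (fun c : 'I_r => s.+1 * (c <= a))%N.
    by case: (c <= a)%N; [right; rewrite muln1|left; rewrite muln0].
  exists f; rewrite ?theta0_l ?theta_deg_l /= ?ltn_ord //.
  by rewrite -big_distrr /= sum_leq_ord in fA.
have [f fA f0] := @augm_zvar_lift F r s s (fun c : 'I_s => (c <= b)%N : nat).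
exists f; rewrite ?theta0_r ?theta_deg_r /= ?[(_ + _ < _)%N]ltnNge ?leq_addr //.
by rewrite sum_leq_ord in fA.
Qed.

Lemma eta_lift (B : box) :
  exists2 f, newton_fam (eta_deg true B) f & kill_z f`_0 = eta0 F true B.
Proof. by apply: augm_yvar_lift => // a; apply: phi_true. Qed.


Variables (th : 'I_n -> {poly P}) (et : box -> {poly P}).
Hypothesis thA : forall i, newton_fam (@theta_deg r s i) (th i).
Hypothesis th0 : forall i : 'I_n,
  (if (i < r)%N then kill_z (th i)`_0 else (th i)`_0) = @theta0 F r s i.
Hypothesis etA : forall B, newton_fam (eta_deg true B) (et B).
Hypothesis et0 : forall B, kill_z (et B)`_0 = eta0 F true B.

(** For plain symmetric polynomials the etas are constant in a; only the thetas are shared by the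
    two cases. *)
Definition eta_fam b (B : box) : {poly P} := if b then et B else (eta0 F false B)%:P.
Definition vfam b (x : 'X_{1..n} * box) : {poly P} := (\prod_i th i ^+ x.1 i) * eta_fam b x.2.

Lemma homog_eta0 b (B : box) : eta0 F b B \is (eta_deg b B).-homog.
Proof.
rewrite /eta0 augm_yvarE; apply: rpred_sum => p _; rewrite dhomogX /= mdeg_bmnm.
rewrite [X in (_ + X)%N]big1 ?addn0 // /eta_deg.
by rewrite [X in _ == X](reindex_inj (@perm_inj _ p)).
Qed.

Lemma homog_eta_fam b B : homog_fam (eta_deg b B) (eta_fam b B).
Proof.
case: b => /= i; first by have [] := etA B.
by rewrite coefC; case: eqP => _; rewrite ?homog_eta0 ?dhomog0.
Qed.

Lemma homog_vfam b x : homog_fam (wdeg x.1 + eta_deg b x.2) (vfam b x).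
Proof.
apply: homog_famM; last exact: homog_eta_fam.
by apply: homog_fam_prod => i; apply: homog_famX; have [] := thA i.
Qed.

Lemma quasi_inv_fam b (f : {poly P}) :
  (forall a, a != 0 -> quasi_inv b a f.[a%:MP]) -> forall a, quasi_inv b a f.[a%:MP].
Proof.
move=> fq a; have [->|] := eqVneq a 0; last exact: fq.
apply/quasi_invP => c; rewrite scale0r addr0 mpolyC0.
apply: (linear_fam_at0 charF (qcond0_linear b c) (qcond1_linear b c)) => a' a'0.
by have /quasi_invP := fq a' a'0; apply.
Qed.

Lemma quasi_inv_th b a i : quasi_inv b a (th i).[a%:MP].
Proof.
apply: quasi_inv_fam => a' a'0; apply: newton_alg_quasi_inv.
by have [+ _] := thA i; apply.
Qed.

Lemma quasi_inv_eta b a B : quasi_inv b a (eta_fam b B).[a%:MP].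
Proof.
apply: quasi_inv_fam => a' a'0; case: b => /=.
  by apply: newton_alg_quasi_inv; have [+ _] := etA B; apply.
by rewrite hornerC; split=> //; apply: bsym_augm_yvar.
Qed.

Lemma vfam_horner b x a :
  (vfam b x).[a%:MP] = msubst (fun i => (th i).[a%:MP]) 'X_[x.1] * (eta_fam b x.2).[a%:MP].
Proof.
rewrite /vfam hornerM mpolyXE_id rmorph_prod -[X in X * _]/(horner_eval _ _) rmorph_prod.
congr (_ * _); apply: eq_bigr => i _.
by rewrite !rmorphXn /= msubstX.
Qed.

Lemma quasi_inv_vfam b a x : quasi_inv b a (vfam b x).[a%:MP].
Proof.
rewrite vfam_horner; apply: quasi_invM; last exact: quasi_inv_eta.
rewrite mpolyXE_id rmorph_prod.
apply: big_ind => [||i _]; [exact: quasi_inv1|exact: quasi_invM|].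
by rewrite rmorphXn /= msubstX; apply: quasi_invX; apply: quasi_inv_th.
Qed.

(** The z-thetas, collected in [A], are homogeneous in z; the other factors, in [u], are known only
    modulo z. Comparing terms of least weight in z reduces the claim to [lin_indep_fibre]. *)
Lemma lin_indep_vfam0 b (J : finType) (x : J -> 'X_{1..n} * box) :
  injective x -> lin_indep (fun j => (vfam b (x j)).[0]).
Proof.
move=> ix.
pose A j : P := \prod_(c < s) theta0 F (rr c) ^+ (x j).1 (rr c).
pose u j : P := (\prod_(a < r) ((th (l a))`_0) ^+ (x j).1 (l a)) * (eta_fam b (x j).2)`_0.
have E j : (vfam b (x j)).[0] = A j * u j.
  rewrite horner_coef0 /vfam coef0M -[X in X * _]/(coefp 0 _) rmorph_prod big_split_ord /=.
  rewrite mulrAC mulrC; congr (_ * _).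
    apply: eq_bigr => c _; rewrite -[LHS]/(coefp 0 _) rmorphXn /= -th0 /= ltnNge leq_addr /=.
    by [].
  congr (_ * _); apply: eq_bigr => c _.
  by rewrite -[LHS]/(coefp 0 _) rmorphXn.
have iAu : lin_indep (fun j => A j * u j).
  apply: (lin_indep_kill_z (wt := fun j => \sum_(c < s) (x j).1 (rr c) * c.+1)%N) => [j|].
    rewrite /A rmorph_prod /= rmorph_prod -prodrXr -big_split; apply: eq_bigr => c _ /=.
    rewrite rmorphXn /= theta0_r scale_z_augm sum_leq_ord exprMn -rmorphXn /= -exprM.
    by rewrite mulnC.
  move=> c cv; apply: (lin_indep_fibre charF (b := b) ix); rewrite -[RHS]cv.
  apply: eq_bigr => j _; congr (_ *: _).
  rewrite /tmon big_split_ord /= /A /u rmorphM rmorph_prod /= mulrCA mulrA; congr (_ * _ * _).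
    by apply: eq_bigr => a _; rewrite rmorphXn /= -[in LHS]th0 /= ltn_ord.
  case: b {E c cv u} => /=; first by rewrite et0.
  rewrite coefC /= /eta0 raddf_sum; apply: eq_bigr => t _.
  by rewrite /= rmorph_prod; apply: eq_bigr => a _; rewrite rmorphXn /= kill_z_yvar.
by move=> c cv; apply: iAu; rewrite -[RHS]cv; apply: eq_bigr => j _; rewrite E.
Qed.

(** The bound on weighted degrees records that the expansion of [f] involves no terms above degree
    D, so cancellation in high degree is excluded. *)
Definition in_span b a D (f : P) := exists2 p : box -> P,
  f = \sum_B msubst (fun i => (th i).[a%:MP]) (p B) * (eta_fam b B).[a%:MP] &
  forall B e, e \in msupp (p B) -> (wdeg e + eta_deg b B <= D)%N.

Lemma generic_in_span_at b D : exists2 c : {poly F}, c.[0] != 0 &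
  forall a, c.[a] != 0 -> forall f, (msize f <= D.+1)%N -> quasi_inv b a f -> in_span b a D f.
Proof.
(* The bounded monomials only make the index set finite; since [mdeg e] is at most [wdeg e], the
   weighted condition loses no pair. *)
pose J := {x : 'X_{1..n < D.+1} * box | (wdeg (x.1 : 'X_{1..n}) + eta_deg b x.2 <= D)%N}.
pose x (j : J) : 'X_{1..n} * box := (((val j).1 : 'X_{1..n}), (val j).2).
have ix : injective x.
  by move=> [[e B] /= h] [[e' B'] /= h'] [/val_inj ? ?]; apply: val_inj; congr (_, _).
have [] := @generic_span F n D (qcond r s) J (qcond0 b) (qcond1 b) (fun j => vfam b (x j))
  (fun j => phim b (lmon (x j).1 (x j).2)).
- exact: qcond0_linear.
- exact: qcond1_linear.
- move=> j i; apply: leq_trans (msize_homog (homog_vfam b (x j) i)) _.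
  by rewrite ltnS; have := valP j.
- by move=> a c j; have /quasi_invP := quasi_inv_vfam b a (x j); apply.
- exact: lin_indep_vfam0.
- move=> f fD f0 fM; apply/eqP/negPn/negP => nf.
  have qf : quasi_inv b 0 f by apply/quasi_invP => c; rewrite f0 scale0r addr0.
  have [e [B mf]] := mcoeff_quasi_inv0 charF qf nf.
  have eBD : (wdeg e + eta_deg b B <= D)%N.
    by rewrite -mdeg_lmon -ltnS (leq_trans _ fD) // msize_mdeg_lt.
  have eD : (mdeg e < D.+1)%N.
    by rewrite ltnS (leq_trans (leq_wdeg e)) // (leq_trans _ eBD) // leq_addr.
  have := fM (exist _ (BMultinom eD, B) eBD).
  by apply/eqP; rewrite -mcoeff_msupp.
move=> c c0 cP; exists c => // a ca f fD /quasi_invP qf.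
have [d ->] := cP a ca f fD qf.
exists (fun B => \sum_(j : J | (x j).2 == B) d j *: 'X_[(x j).1]).
  rewrite (partition_big (fun j => (x j).2) predT) //=; apply: eq_bigr => B _.
  rewrite raddf_sum mulr_suml; apply: eq_bigr => j /eqP <-.
  by rewrite vfam_horner /= linearZ /= scalerAl.
move=> B e /msupp_sum_le /flatten_mapP[j]; rewrite mem_filter => /andP[/eqP <- _].
move=> /msuppZ_le; rewrite msuppX mem_seq1 => /eqP ->.
exact: (valP j).
Qed.

(** The product of the exceptional polynomials serves all degrees up to D at once. *)
Lemma generic_in_span b D : exists2 c : {poly F}, c.[0] != 0 &
  forall a, c.[a] != 0 -> forall d f, (d <= D)%N -> (msize f <= d.+1)%N ->
    quasi_inv b a f -> in_span b a d f.
Proof.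
elim: D => [|D [c c0 cP]].
  have [c c0 cP] := generic_in_span_at b 0; exists c => // a ca d f.
  by rewrite leqn0 => /eqP ->; apply: cP.
have [c' c'0 c'P] := generic_in_span_at b D.+1.
exists (c * c') => [|a]; first by rewrite hornerM mulf_neq0.
rewrite hornerM mulf_eq0 negb_or => /andP[ca c'a] d f.
by rewrite leq_eqVlt ltnS => /orP[/eqP ->|dD]; [apply: c'P|apply: cP].
Qed.

End Generic.

(** * Free modules *)

Section FreeModules.
Variables (A R : idomainType) (T : {rmorphism A -> R}) (I : finType).

Definition free_over (v : I -> R) :=
  forall w : I -> A, \sum_i T (w i) * v i = 0 -> forall i, w i = 0.

Lemma sum_rmorph_enum (w : 'rV[A]_#|I|) (X : 'M[A]_#|I|) (v : I -> R) :
  \sum_i T (w 0 (enum_rank i)) * (\sum_j T (X (enum_rank i) (enum_rank j)) * v j)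
  = \sum_j T ((w *m X) 0 (enum_rank j)) * v j.
Proof.
under eq_bigr do rewrite mulr_sumr.
rewrite exchange_big; apply: eq_bigr => j _; rewrite mxE rmorph_sum mulr_suml.
rewrite (reindex (@enum_rank I)) /=; last by exists enum_val => ? _; rewrite ?enum_rankK ?enum_valK.
by apply: eq_bigr => i _; rewrite rmorphM mulrA.
Qed.

(* The matrix of d h in terms of v is nonsingular, and its adjugate expresses v back. *)
Lemma free_over_gen (h v : I -> R) (d : R) : d != 0 -> free_over h ->
  (forall i, exists m : I -> A, d * h i = \sum_j T (m j) * v j) -> free_over v.
Proof.
move=> d0 fh /fin_all_exists[m mE] w wv.
pose M : 'M[A]_#|I| := \matrix_(i, j) m (enum_val i) (enum_val j).
have ME i : d * h i = \sum_j T (M (enum_rank i) (enum_rank j)) * v j.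
  by rewrite mE; apply: eq_bigr => j _; rewrite mxE !enum_rankK.
have dh (u : 'rV[A]_#|I|) : \sum_j T ((u *m M) 0 (enum_rank j)) * v j = 0 -> u = 0.
  move=> E; apply/rowP => i; rewrite mxE -(enum_valK i).
  apply: (fh (fun i => u 0 (enum_rank i))); apply: (mulfI d0).
  rewrite mulr0 -[RHS]E -sum_rmorph_enum mulr_sumr; apply: eq_bigr => j _.
  by rewrite -ME mulrCA.
have M0 : \det M != 0.
  apply/det0P => -[u u0 uM]; case/negP: u0; apply/eqP; apply: dh.
  by rewrite uM big1 // => j _; rewrite mxE rmorph0 mul0r.
pose u : 'rV[A]_#|I| := \row_i w (enum_val i).
have uE j : w j = u 0 (enum_rank j) by rewrite mxE enum_rankK.
have : u *m \adj M = 0.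
  apply: dh; rewrite -mulmxA mul_adj_mx mul_mx_scalar.
  transitivity (T (\det M) * \sum_j T (w j) * v j); last by rewrite wv mulr0.
  by rewrite mulr_sumr; apply: eq_bigr => j _; rewrite mxE rmorphM uE mulrA.
move=> /(congr1 (mulmx^~ M)); rewrite -mulmxA mul_adj_mx mul_mx_scalar mul0mx => E i.
have /rowP/(_ (enum_rank i)) := E; rewrite !mxE enum_rankK => /eqP.
by rewrite mulf_eq0 (negPf M0) => /eqP.
Qed.

(* Cayley-Hamilton: N does not depend on x, so one monic polynomial kills all such x. *)
Lemma char_poly_common (N : 'M[A]_#|I|) (v : I -> R) (x : R) (i0 : I) : v i0 != 0 ->
  (forall i, x * v i = \sum_j T (N (enum_rank i) (enum_rank j)) * v j) ->
  \sum_(m < #|I|.+1) T (char_poly N)`_m * x ^+ m = 0.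
Proof.
move=> v0 xv; pose V : 'cV[R]_#|I| := \col_i v (enum_val i).
pose B := x%:M - map_mx T N.
have BV : B *m V = 0.
  apply/colP => i; rewrite mulmxBl mul_scalar_mx !mxE -(enum_valK i) enum_rankK xv.
  apply/eqP; rewrite subr_eq0; apply/eqP.
  rewrite [RHS](reindex (@enum_rank I)) /=; last by exists enum_val => ? _;
    rewrite ?enum_rankK ?enum_valK.
  by apply: eq_bigr => j _; rewrite !mxE enum_rankK.
have dB : \det B = 0.
  have /(congr1 (mulmx (\adj B)))/colP/(_ (enum_rank i0)) := BV.
  rewrite mulmxA mul_adj_mx mul_scalar_mx mulmx0 !mxE enum_rankK => /eqP.
  by rewrite mulf_eq0 (negPf v0) orbF => /eqP.
rewrite -[RHS]dB; have <- : (map_poly T (char_poly N)).[x] = \det B.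
  rewrite map_char_poly /char_poly -[LHS]/(horner_eval x _) -det_map_mx; congr (\det _).
  by apply/matrixP => i j; rewrite /B /char_poly_mx !mxE /= /horner_eval hornerD hornerN hornerC
    hornerMn hornerX.
rewrite (@horner_coef_wide _ #|I|.+1).
  by apply: eq_bigr => m _; rewrite coef_map.
by rewrite (leq_trans (size_poly _ _)) // size_char_poly.
Qed.

End FreeModules.

(** Setting the earlier variables to 0 has the ideal they generate as its kernel, and it leaves
    ['X_i] a nonzero element of a domain. *)
Lemma regular_vars (F : fieldType) n (i : 'I_n) (p : {mpoly F[n]}) (q : 'I_n -> {mpoly F[n]}) :
  p * 'X_i = \sum_(j < n | (j < i)%N) q j * 'X_j ->
  exists u : 'I_n -> {mpoly F[n]}, p = \sum_(j < n | (j < i)%N) u j * 'X_j.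
Proof.
pose t : {rmorphism {mpoly F[n]} -> {mpoly F[n]}} :=
  msubst (fun j : 'I_n => if (j < i)%N then 0 else 'X_j).
have tX j : t 'X_j = if (j < i)%N then 0 else 'X_j by rewrite /t /= msubstX.
(* [Q f] says that [f] and [t f] agree modulo the earlier variables. *)
pose Q f := exists u : 'I_n -> {mpoly F[n]}, f = t f + \sum_(j < n | (j < i)%N) u j * 'X_j.
have QC c : Q c%:MP.
  by exists (fun=> 0); rewrite big1 => [|j _]; rewrite ?mul0r // addr0 /t /= msubstC.
have QD f g : Q f -> Q g -> Q (f + g).
  move=> [u fE] [u' gE]; exists (fun j => u j + u' j).
  under eq_bigr do rewrite mulrDl; rewrite big_split rmorphD /= {1}fE {1}gE.
  by rewrite addrACA.
have QM f g : Q f -> Q g -> Q (f * g).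
  move=> [u fE] [u' gE]; exists (fun j => t f * u' j + u j * g).
  under eq_bigr do rewrite mulrDl -!mulrA.
  rewrite big_split rmorphM /= -mulr_sumr.
  under [X in _ + (_ + X)]eq_bigr do rewrite [g * _]mulrC mulrA.
  by rewrite -mulr_suml {1}fE mulrDl addrA -mulrDr -gE.
have QX j : Q 'X_j.
  rewrite /Q tX; case: ifP => ji; last first.
    by exists (fun=> 0); rewrite big1 ?addr0 // => ? _; rewrite mul0r.
  exists (fun l => (l == j)%:R).
  rewrite add0r (bigD1 j) //= eqxx mul1r big1 ?addr0 // => l /andP[_ /negPf ->].
  by rewrite mul0r.
have Qall : forall f, Q f by exact: mpoly_alg_ind.
move=> E; have tp : t p = 0.
  have /(congr1 t) := E; rewrite rmorphM raddf_sum /= big1 => [|j ji]; last first.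
    by rewrite rmorphM /= tX ji mulr0.
  move=> /eqP; rewrite mulf_eq0 => /orP[/eqP //|]; rewrite tX ltnn.
  move=> /eqP /(congr1 (mcoeff U_(i))) /eqP.
  by rewrite mcoeffXU eqxx mcoeff0 (oner_eq0 F).
by have [u pE] := Qall p; exists u; rewrite {1}pE tp add0r.
Qed.

(** * Specialization at a good parameter *)

Lemma eq_msubst (R : comNzRingType) n m (h h' : 'I_n -> {mpoly R[m]}) p :
  h =1 h' -> msubst h p = msubst h' p.
Proof.
move=> hE; apply: (mpoly_rmorph_ext (f := msubst h) (g := msubst h')) => [c|i] /=.
  by rewrite !msubstC.
by rewrite !msubstX.
Qed.

Section Endgame.
Variables (F : fieldType) (r s : nat).
Local Notation n := (r + s)%N.
Local Notation P := {mpoly F[n]}.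
Local Notation box := {ffun 'I_r -> 'I_s.+1}.
Local Notation tdeg := (@theta_deg r s).
Local Notation bsym := (@bsym r s F).
Local Notation quasi_inv := (@quasi_inv F r s).
Hypothesis charF : [pchar F] =i pred0.
Variables (th : 'I_n -> {poly P}) (et : box -> {poly P}).
Hypothesis thA : forall i, newton_fam (tdeg i) (th i).
Hypothesis th0 : forall i : 'I_n,
  (if (i < r)%N then kill_z (th i)`_0 else (th i)`_0) = @theta0 F r s i.
Hypothesis etA : forall B, newton_fam (eta_deg true B) (et B).
Hypothesis et0 : forall B, kill_z (et B)`_0 = eta0 F true B.

Local Notation T a := (msubst (fun i => (th i).[a%:MP])).
Local Notation eta b a B := ((eta_fam et b B).[a%:MP]).
Local Notation in_span := (in_span th et).

Lemma in_span0 b a d : in_span b a d 0.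
Proof.
exists (fun=> 0) => [|B e]; first by rewrite big1 // => B _; rewrite rmorph0 mul0r.
by rewrite msupp0.
Qed.

Lemma in_spanD b a d f g : in_span b a d f -> in_span b a d g -> in_span b a d (f + g).
Proof.
move=> [p -> pd] [q -> qd]; exists (fun B => p B + q B) => [|B e].
  by rewrite -big_split; apply: eq_bigr => B _; rewrite rmorphD mulrDl.
by move=> /msuppD_le; rewrite mem_cat => /orP[/pd|/qd].
Qed.

Lemma in_span_mono b a d d' f : (d <= d')%N -> in_span b a d f -> in_span b a d' f.
Proof. by move=> dd [p -> pd]; exists p => // B e /pd /leq_trans; apply. Qed.

Lemma in_span_mul b a d0 d q g : (forall e, e \in msupp q -> (wdeg e + d0 <= d)%N) ->
  in_span b a d0 g -> in_span b a d (T a q * g).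
Proof.
move=> qd [p -> pd]; exists (fun B => q * p B) => [|B e].
  by rewrite mulr_sumr; apply: eq_bigr => B _; rewrite rmorphM mulrA.
move=> /msuppM_le /allpairsP[[e1 e2] /= [/qd e1q /pd e2p ->]].
by rewrite wdegD -addnA (leq_trans _ e1q) // leq_add2l.
Qed.

Lemma in_span_sum b a d (I : Type) (q : seq I) (Q : pred I) (f : I -> P) :
  (forall i, Q i -> in_span b a d (f i)) -> in_span b a d (\sum_(i <- q | Q i) f i).
Proof. by move=> fs; apply: big_ind => //; [apply: in_span0|apply: in_spanD]. Qed.

Lemma in_spanZ b a d c f : in_span b a d f -> in_span b a d (c *: f).
Proof.
move=> fs; rewrite -mul_mpolyC -(msubstC (fun i => (th i).[a%:MP])); apply: in_span_mul fs.
move=> e; rewrite msuppC; case: eqP => // _; rewrite mem_seq1 => /eqP ->.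
by rewrite /wdeg big1 // => i _; rewrite mnm0E.
Qed.

Definition wbox d := [pred x : 'X_{1..n < d.+1} * box |
  (wdeg (x.1 : 'X_{1..n}) + eta_deg false x.2 <= d)%N].

(** Turns coefficients in the polynomial ring into finitely many scalars, so that linear algebra
    over [F] applies. *)
Lemma span_expand a d (p : box -> P) :
  (forall B e, e \in msupp (p B) -> (wdeg e + eta_deg false B <= d)%N) ->
  \sum_B T a (p B) * eta false a B =
  \sum_(j < #|wbox d|) (p (enum_val j).2)@_(enum_val j).1 *:
     (vfam th et false (((enum_val j).1 : 'X_{1..n}), (enum_val j).2)).[a%:MP].
Proof.
move=> pd; rewrite -(big_enum_val (A := wbox d) (fun x => (p x.2)@_x.1 *:
  (vfam th et false ((x.1 : 'X_{1..n}), x.2)).[a%:MP])).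
transitivity (\sum_(e : 'X_{1..n < d.+1}) \sum_(B : box)
  if (e, B) \in wbox d then (p B)@_e *: (vfam th et false ((e : 'X_{1..n}), B)).[a%:MP] else 0);
    last first.
  by rewrite pair_bigA [in RHS]big_mkcond; apply: eq_bigr => -[].
rewrite exchange_big; apply: eq_bigr => B _ /=.
have pB : (msize (p B) <= d.+1)%N.
  rewrite msizeE; apply/bigmax_leqP_seq => e ep _; rewrite ltnS.
  by apply: leq_trans (pd B e ep); rewrite (leq_trans (leq_wdeg e)) // leq_addr.
rewrite {1}(mpolywE pB) raddf_sum mulr_suml; apply: eq_bigr => e _ /=.
rewrite vfam_horner inE /= linearZ /= -scalerAl; case: ifP => // /negbT eB.
by rewrite (memN_msupp_eq0 (m := e)) ?scale0r //; apply: contra eB => /pd.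
Qed.

(** * Freeness and generation at one fixed good parameter *)

Section GoodParameter.
Variables (a : F) (D : nat).
Hypothesis a0 : a != 0.
Hypothesis spanF : forall d f, (d <= D)%N -> (msize f <= d.+1)%N ->
  quasi_inv false a f -> in_span false a d f.
Hypothesis spanT : forall d f, (d <= D)%N -> (msize f <= d.+1)%N ->
  quasi_inv true a f -> in_span true a d f.
Hypothesis span0 : forall d f, (msize f <= d.+1)%N ->
  quasi_inv false 0 f -> in_span false 0 d f.
Hypothesis etaD : forall B : box, (eta_deg false B <= D)%N.
Hypothesis thD : forall i (B : box), (tdeg i + eta_deg false B <= D)%N.

Lemma quasi_inv_falseP a1 f : quasi_inv false a1 f <-> bsym f.
Proof. by split=> [[]|]. Qed.

Lemma msize_vfam0 x : (msize (vfam th et false x).[0%:MP] <= (wdeg x.1 + eta_deg false x.2).+1)%N.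
Proof. exact/msize_homog/homog_fam_horner/homog_vfam. Qed.

Lemma eta_falseE a1 B : eta false a1 B = eta0 F false B.
Proof. by rewrite /= hornerC. Qed.

Lemma bsym_eta_false (B : box) : bsym (eta0 F false B).
Proof. exact: bsym_augm_yvar. Qed.

Lemma bsym_th a1 i : bsym (th i).[a1%:MP].
Proof. by have [] := quasi_inv_th charF thA false a1 i. Qed.

Lemma msize_th_eta a1 i (B : box) : (msize ((th i).[a1%:MP] * eta0 F false B) <= (tdeg i + eta_deg
  false B).+1)%N.
Proof.
apply: msize_homog; apply: dhomogM; last exact: homog_eta0.
by apply: homog_fam_horner => j; have [_] := thA i.
Qed.

(** Passes from degrees up to D to all degrees. Expand [f] at a = 0, where spanning holds in every
    degree, and split one theta off each term. The rest has smaller degree and is expanded at a by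
    induction; the split theta times an eta has degree at most D. *)
Lemma bsym_in_span d f : (msize f <= d.+1)%N -> bsym f -> in_span false a d f.
Proof.
elim/ltn_ind: d f => d IHd f fd sf.
have [dD|Dd] := leqP d D; first by apply: spanF => //; apply/quasi_inv_falseP.
have [p -> pd] := span0 fd ((quasi_inv_falseP 0 f).2 sf).
apply: in_span_sum => B _; rewrite (mpolyE (p B)) raddf_sum mulr_suml.
rewrite big_seq; apply: in_span_sum => e ep /=; rewrite linearZ /= -scalerAl.
apply: in_spanZ; have eBd := pd B e ep.
have [e0|[i ei]] : e = 0%MM \/ exists i, (0 < e i)%N.
  have [i ei|e0] := pickP (fun i => e i != 0%N); [right; exists i|left].
    by rewrite lt0n.
  by apply/mnmP => i; rewrite mnm0E; apply/eqP/negPn; rewrite e0.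
  rewrite e0 mpolyX0 rmorph1 mul1r eta_falseE; apply: (in_span_mono (d := D)); first exact: ltnW.
  apply: spanF => //; last by apply/quasi_inv_falseP/bsym_eta_false.
  apply: leq_trans (msize_homog (homog_eta0 _ _ _)) _; rewrite ltnS.
  exact: etaD.
pose e' := (e - U_(i))%MM.
have eE : e = (U_(i) + e')%MM by rewrite addmC submK // lep1mP -lt0n.
have we : (tdeg i + (wdeg e' + eta_deg false B) <= d)%N.
  by rewrite addnA -(@wdeg1 r s i) -wdegD -eE.
have ti : (0 < tdeg i)%N := theta_deg_gt0 i.
have [|||p' p'E p'd] := IHd (d - tdeg i)%N _ ((vfam th et false (e', B)).[0%:MP]).
- by rewrite ltn_subrL ti (leq_trans _ Dd).
- apply: leq_trans (msize_vfam0 _) _; rewrite ltnS /=; lia.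
- by have [] := quasi_inv_vfam charF thA etA false 0 (e', B).
have vE := vfam_horner th et false (e', B) 0.
rewrite eE mpolyXD rmorphM /= msubstX -mulrA -vE p'E mulr_sumr.
apply: in_span_sum => B' _; rewrite mulrCA.
apply: (in_span_mul (d0 := tdeg i + eta_deg false B')) => [e2 e2p|].
  by have := p'd B' e2 e2p; lia.
rewrite eta_falseE -(eta_falseE 0) eta_falseE.
apply: spanF => //; first exact: msize_th_eta.
by apply/quasi_inv_falseP/bsymM; [apply: bsym_th|apply: bsym_eta_false].
Qed.

(** In bounded degree the products theta^e eta_B at 0 are independent and lie in the span of the
    products at a with the same indices, so the latter are independent too. *)
Lemma free_eta_false : free_over (T a) (fun B => eta false a B).
Proof.
move=> w wh B; apply/mpolyP => e; rewrite mcoeff0; apply/eqP/negPn/negP => eB.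
pose d := (\max_B \max_(e <- msupp (w B)) (wdeg e + eta_deg false B))%N.
have wd B' e' : e' \in msupp (w B') -> (wdeg e' + eta_deg false B' <= d)%N.
  move=> e'w; apply: leq_trans (leq_bigmax B').
  exact: (leq_bigmax_seq (F := fun e => (wdeg e + eta_deg false B')%N)).
pose x (j : 'I_#|wbox d|) : 'X_{1..n} * box := (((enum_val j).1 : 'X_{1..n}), (enum_val j).2).
have ix : injective x.
  move=> j j'; rewrite /x => -[/val_inj E1 E2]; apply: enum_val_inj.
  by rewrite [LHS]surjective_pairing [RHS]surjective_pairing E1 E2.
have iv := lin_indep_vfam0 charF th0 et0 (b := false) ix.
have xd j : (wdeg (x j).1 + eta_deg false (x j).2 <= d)%N.
  by have := enum_valP j; rewrite inE.
have iw : lin_indep (fun j => (vfam th et false (x j)).[a%:MP]).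
  apply: lin_indep_span iv _ => j.
  have fd : (msize (vfam th et false (x j)).[0%:MP] <= d.+1)%N.
    by apply: leq_trans (msize_vfam0 _) _; rewrite ltnS.
  have fs : bsym (vfam th et false (x j)).[0%:MP].
    by have [] := quasi_inv_vfam charF thA etA false 0 (x j).
  have [p pE pd] := bsym_in_span fd fs; rewrite mpolyC0 in pE.
  by eexists; apply: etrans pE (span_expand a pd).
have eBd := wd B e; rewrite mcoeff_msupp in eBd; have {}eBd := eBd eB.
have eD : (mdeg e < d.+1)%N.
  by rewrite ltnS (leq_trans (leq_wdeg e)) // (leq_trans _ eBd) // leq_addr.
have eW : (BMultinom eD, B) \in wbox d by rewrite inE.
have := iw _ (etrans (esym (span_expand a wd)) wh) (enum_rank_in eW (BMultinom eD, B)).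
by rewrite enum_rankK_in //=; apply/eqP.
Qed.

Hypothesis vD : forall B, (msize (vander F r s ^+ 2 * eta0 F false B) <= D.+1)%N.

(** The multiples by delta^2 of the symmetric etas are quasi-invariant, hence combinations of the
    equally many etas of the algebra; [free_over_gen] transfers freeness. *)
Lemma free_eta_true : free_over (T a) (fun B => eta true a B).
Proof.
apply: (free_over_gen (d := vander F r s ^+ 2) _ free_eta_false) => [|B].
  by rewrite expf_neq0 // vander_neq0.
have [||p pE _] := @spanT D (vander F r s ^+ 2 * eta false a B) (leqnn D).
- by rewrite eta_falseE.
- by rewrite eta_falseE; apply/quasi_inv_vander/bsym_eta_false.
by exists p.
Qed.

(** Its coefficients are symmetric in all variables, so one monic polynomial shows every variable
    integral over the symmetric polynomials. *)
Definition var_poly : {poly P} := \prod_(i < n) ('X - ('X_i)%:P).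

Lemma bsym_var_poly m : bsym (var_poly`_m).
Proof.
move=> i j ij; rewrite -coef_map; congr (nth 0 (polyseq _) m).
rewrite /var_poly rmorph_prod [RHS](reindex_inj (@perm_inj _ (tperm i j))) /=.
by apply: eq_bigr => q _; rewrite rmorphB /= map_polyX map_polyC /= msym_var.
Qed.

Lemma size_var_poly : size var_poly = n.+1.
Proof. by rewrite size_prod_XsubC /index_enum -enumT size_enum_ord. Qed.

Lemma var_poly_monic : var_poly \is monic.
Proof. exact: monic_prod_XsubC. Qed.

Lemma var_poly_root i : \sum_(m < n.+1) var_poly`_m * 'X_i ^+ m = 0.
Proof.
rewrite -size_var_poly -horner_coef; apply/eqP; change (is_true (root var_poly 'X_i));
  apply/factor_theorem.
exists (\prod_(j < n | j != i) ('X - ('X_j)%:P)).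
by rewrite /var_poly (bigD1 i) //= mulrC.
Qed.

Hypothesis cD : forall m B, (msize (var_poly`_m * eta0 F false B) <= D.+1)%N.
Local Notation I := (box * 'I_n)%type.
Hypothesis hn : (0 < n)%N.

(** The module generated by the eta_B x^m with m < n is stable under multiplication by x, for x any
    of the variables, and the matrix is the same for all of them because only [var_poly] enters.
    Cayley-Hamilton then gives a common monic relation. *)
Lemma common_relation : exists q : 'I_#|{: I}| -> P, forall i : 'I_n,
  'X_i ^+ #|{: I}| = \sum_(m < #|{: I}|) T a (q m) * 'X_i ^+ m.
Proof.
pose v (i : 'I_n) (x : I) : P := eta false a x.1 * 'X_i ^+ x.2.
have row (x : I) : exists w : I -> P, forall i, 'X_i * v i x = \sum_y T a (w y) * v i y.
  case: x => B m; have [mn|nm] := ltnP m.+1 n.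
    exists (fun y => (y == (B, Ordinal mn))%:R) => i.
    rewrite (bigD1 (B, Ordinal mn)) //= eqxx rmorph1 mul1r big1 => [|y /negPf ->].
      by rewrite addr0 /v /= mulrCA exprS.
    by rewrite rmorph0 mul0r.
  (* The top power is lowered by [var_poly], whose coefficients times an eta are symmetric of degree
     at most D, hence in the span. *)
  have mE : m.+1 = n by apply/eqP; rewrite eqn_leq ltn_ord.
  have /fin_all_exists[p pE] (m' : 'I_n) : exists p : box -> P,
      var_poly`_m' * eta0 F false B = \sum_B' T a (p B') * eta false a B'.
    have [||p pE _] := @spanF D (var_poly`_m' * eta0 F false B) (leqnn D); first exact: cD.
      by apply/quasi_inv_falseP/bsymM; [apply: bsym_var_poly|apply: bsym_eta_false].
    by exists p.
  exists (fun y => - p y.2 y.1) => i.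
  rewrite /v /= mulrCA -exprS mE eta_falseE.
  have := var_poly_root i; rewrite big_ord_recr /=.
  have -> : var_poly`_n = 1.
    by have /monicP := var_poly_monic; rewrite lead_coefE size_var_poly.
  rewrite mul1r addrC => /eqP; rewrite addr_eq0 => /eqP ->.
  rewrite mulrN mulr_sumr -sumrN.
  transitivity (\sum_(m' < n) \sum_B' T a (- p m' B') * (eta false a B' * 'X_i ^+ m')).
    apply: eq_bigr => m' _; rewrite mulrA [_ * var_poly`_m']mulrC pE mulr_suml -sumrN.
    by apply: eq_bigr => B' _; rewrite rmorphN mulNr mulrA.
  by rewrite exchange_big pair_bigA.
have /fin_all_exists[w wE] := row.
pose N : 'M[P]_#|{: I}| := \matrix_(i, j) w (enum_val i) (enum_val j).
pose q := char_poly N; exists (fun m => - q`_m) => i.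
have [B0] : exists B : box, true by exists [ffun=> ord0].
have v0 : v i (B0, Ordinal hn) != 0.
  rewrite /v /= expr0 mulr1 eta_falseE.
  by have [] := @mlead_augm_yvar F r s charF _ (@part_nonincr r s B0).
move=> _; have Nv x : 'X_i * v i x = \sum_y T a (N (enum_rank x) (enum_rank y)) * v i y.
  by rewrite wE; apply: eq_bigr => y _; rewrite mxE !enum_rankK.
have := char_poly_common v0 Nv.
rewrite big_ord_recr /=.
have -> : (char_poly N)`_#|{: I}| = 1.
  by have /monicP := char_poly_monic N; rewrite lead_coefE size_char_poly.
rewrite rmorph1 mul1r addrC => /eqP; rewrite addr_eq0 => /eqP ->.
by rewrite -sumrN; apply: eq_bigr => m _; rewrite rmorphN mulNr.
Qed.

(** As weighted power sums of all variables, the Newton sums inherit any recurrence common to the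
    powers of the variables. *)
Lemma newtonE c : newton r s a c = \sum_(i < n) (if (i < r)%N then a else 1) *: 'X_i ^+ c.
Proof.
rewrite big_split_ord /newton /psum scaler_sumr /=; congr (_ + _); apply: eq_bigr => i _.
  by rewrite ltn_ord.
by rewrite ltnNge leq_addr scale1r.
Qed.

Lemma newton_homog c : newton r s a c \is c.-homog.
Proof.
rewrite newtonE; apply: rpred_sum => i _; apply: dhomogZ.
have h : ('X_i : P) \is 1.-homog by rewrite dhomogX /= mdeg1.
by have := dhomogMn c h; rewrite mul1n.
Qed.

Definition hook_span (f : P) := exists p : box -> P, f = \sum_B T a (p B) * eta true a B.

Lemma hook_spanD f g : hook_span f -> hook_span g -> hook_span (f + g).
Proof.
move=> [p ->] [q ->]; exists (fun B => p B + q B).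
by rewrite -big_split; apply: eq_bigr => B _; rewrite rmorphD mulrDl.
Qed.

Lemma hook_span_mul q f : hook_span f -> hook_span (T a q * f).
Proof.
move=> [p ->]; exists (fun B => q * p B).
by rewrite mulr_sumr; apply: eq_bigr => B _; rewrite rmorphM mulrA.
Qed.

Lemma hook_span0 : hook_span 0.
Proof. by exists (fun=> 0); rewrite big1 // => B _; rewrite rmorph0 mul0r. Qed.

Lemma hook_span_sum (J : Type) (q : seq J) (Q : pred J) (f : J -> P) :
  (forall i, Q i -> hook_span (f i)) -> hook_span (\sum_(i <- q | Q i) f i).
Proof. by move=> fs; apply: (big_ind hook_span) => //; [apply: hook_span0|apply: hook_spanD]. Qed.

Hypothesis nD : forall B : box, (#|{: I}| + eta_deg true B <= D)%N.

(** Small indices fall under the spanning hypothesis up to degree D; larger ones are reduced by the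
    recurrence of [common_relation]. *)
Lemma hook_span_newton_eta c B : hook_span (newton r s a c.+1 * eta true a B).
Proof.
elim/ltn_ind: c => c IHc; have [cK|Kc] := ltnP c #|{: I}|.
  have [||p pE _] := @spanT D (newton r s a c.+1 * eta true a B) (leqnn D); last by exists p.
    have eH := homog_fam_horner a (homog_eta_fam etA true B).
    apply: leq_trans (msize_homog (dhomogM (newton_homog _) eH)) _.
    by rewrite ltnS (leq_trans _ (nD B)) // leq_add2r.
  by apply: quasi_invM; [apply: quasi_inv_newton|apply: (quasi_inv_eta charF etA)].
have [q qE] := common_relation.
(* The indices on the right stay positive and below c+1, so the induction hypothesis covers them. *)
have -> : newton r s a c.+1 =
    \sum_(m < #|{: I}|) T a (q m) * newton r s a ((c - #|{: I}|).+1 + m).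
  have {1}-> : c.+1 = ((c - #|{: I}|).+1 + #|{: I}|)%N by rewrite addSn subnK.
  rewrite newtonE; under [RHS]eq_bigr do rewrite newtonE mulr_sumr.
  rewrite [RHS]exchange_big; apply: eq_bigr => i _.
  rewrite exprD qE mulr_sumr scaler_sumr; apply: eq_bigr => m _ /=.
  by rewrite exprD mulrCA -!scalerAr.
rewrite mulr_suml; apply: hook_span_sum => m _; rewrite -mulrA addSn.
by apply: hook_span_mul; apply: IHc; have := ltn_ord m; lia.
Qed.

Lemma newton_alg_hook_span f : newton_alg a f -> hook_span f.
Proof.
move=> [m [q ->]].
(* Multipliers preserving the span form an algebra that contains the Newton sums; it remains to
   apply them to 1, which lies in the span. *)
pose Q p := forall g, hook_span g -> hook_span (p * g).
have Q1 : Q 1 by move=> g; rewrite mul1r.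
have QM p1 p2 : Q p1 -> Q p2 -> Q (p1 * p2).
  by move=> h1 h2 g gW; rewrite -mulrA; apply/h1/h2.
have Qf : Q (msubst (fun i : 'I_m => newton r s a i.+1) q).
  rewrite (mpolyE q) raddf_sum; apply: (big_ind Q) => [|p1 p2 h1 h2|e _] /=.
  - by move=> g _; rewrite mul0r; apply: hook_span0.
  - by move=> g gW; rewrite mulrDl; apply: hook_spanD; [apply: h1|apply: h2].
  rewrite -mul_mpolyC rmorphM /= msubstC; apply: (QM).
    by move=> g gW; rewrite -(msubstC (fun i => (th i).[a%:MP])); apply: hook_span_mul.
  rewrite mpolyXE_id rmorph_prod; apply: (big_ind Q) => [||i _] //.
  rewrite rmorphXn /= msubstX; elim: (e i) => [|k IHk]; first by rewrite expr0.
  rewrite exprS; apply: (QM) IHk => g [p ->]; rewrite mulr_sumr; apply: hook_span_sum => B _.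
  by rewrite mulrCA; apply/hook_span_mul/hook_span_newton_eta.
have [||p pE _] := @spanT D 1 (leqnn D).
- by rewrite msize1.
- exact: quasi_inv1.
by rewrite -[msubst _ q]mulr1; apply: Qf; exists p.
Qed.

Lemma newton_alg_th i : newton_alg a (th i).[a%:MP].
Proof. by have [+ _] := thA i; apply. Qed.

Lemma newton_alg_eta B : newton_alg a (eta true a B).
Proof. by have [+ _] := etA B; apply. Qed.

Lemma hook_span_newton_alg f : hook_span f -> newton_alg a f.
Proof.
move=> [p ->]; apply: newton_alg_sum => B _; apply: newton_algM; last exact: newton_alg_eta.
by apply: newton_alg_msubst => i; apply: newton_alg_th.
Qed.

(** The algebra is free on the etas over the ring of the thetas, so membership in the ideal of the
    first thetas is read off coefficientwise, and regularity reduces to that of the variables of a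
    polynomial ring. *)
Lemma newton_alg_CohenMacaulay : CohenMacaulay (newton_alg (r := r) (s := s) a).
Proof.
pose ths := [seq (th i).[a%:MP] | i <- enum 'I_n].
pose etas := [seq eta true a B | B <- enum {: box}].
have sth : size ths = n by rewrite size_map size_enum_ord.
have nth_th (i : 'I_n) : ths`_i = (th i).[a%:MP].
  by rewrite (nth_map i) ?size_enum_ord // nth_ord_enum.
have nth_take_th (i j : 'I_n) : (j < i)%N -> (take i ths)`_j = (th j).[a%:MP].
  by move=> ji; rewrite nth_take.
have seta : size etas = #|{: box}| by rewrite size_map cardE.
have sum_eta (p : box -> P) : \sum_B T a (p B) * eta true a B =
    \sum_(j < size etas) [seq T a (p B) | B <- enum {: box}]`_j * etas`_j.
  have [B0] : exists B : box, true by exists [ffun=> ord0].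
  move=> _; rewrite seta.
  rewrite -(big_mkord predT (fun j => [seq T a (p B) | B <- enum {: box}]`_j * etas`_j)).
  rewrite -big_enum (big_nth B0) -cardE; apply: eq_big_nat => j /andP[_ jK].
  have jS : (j < size (enum {: box}))%N by rewrite -cardE.
  rewrite (nth_map B0 0 _ jS) (nth_map B0 0 _ jS).
  by congr (T a (p (nth B0 _ j)) * eta true a (nth B0 _ j)); apply: eq_enum.
exists ths, etas; split.
- move=> t /mapP[i _ ->]; split; first exact: newton_alg_th.
  exists (tdeg i); split; first exact: theta_deg_gt0.
  by apply: homog_fam_horner => j; have [_] := thA i.
- by move=> e /mapP[B _ ->]; apply: newton_alg_eta.
- move=> f /newton_alg_hook_span[p ->]; exists [seq T a (p B) | B <- enum {: box}].
  split; [by rewrite !size_map| |exact: sum_eta].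
  move=> x /mapP[B _ ->].
  (* The length of [ths] equals n only propositionally, so the variables are renamed along a
     cast. *)
  exists (msubst (fun i : 'I_n => 'X_(cast_ord (esym sth) i)) (p B)).
  have -> : in_tuple ths = [tuple (tnth (in_tuple ths) i) | i < size ths].
    by apply: eq_from_tnth => i; rewrite tnth_mktuple.
  rewrite -[RHS]/(msubst _ _) msubst_comp; apply: eq_msubst => i.
  by rewrite msubstX (tnth_nth 0) /= nth_th.
move=> i f; rewrite sth => im fA [g [sg gA]].
pose i' := Ordinal im; have st : size (take i ths) = i by rewrite size_take sth im.
have -> : ths`_i = (th i').[a%:MP] by rewrite -nth_th.
have [p pE] := newton_alg_hook_span fA.
have gW (j : 'I_n) : exists q : box -> P, (j < i)%N -> g`_j = \sum_B T a (q B) * eta true a B.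
  case ji: (j < i)%N; last by exists (fun=> 0).
  have [|q qE] := newton_alg_hook_span (gA g`_j _); last by exists q.
  by apply: mem_nth; rewrite sg st.
have {gW}[q qE] := fin_all_exists gW.
have sumE (u : nat -> P) : \sum_(j < size (take i ths)) u j * (take i ths)`_j =
    \sum_(j < n | (j < i)%N) u j * (th j).[a%:MP].
  rewrite st (big_ord_widen_cond n predT (fun j => u j * (take i ths)`_j)) ?(ltnW im) //.
  by apply: eq_bigr => j /= ji; rewrite -(nth_take_th i').
rewrite sumE => fE.
(* Freeness splits the relation into one for each eta, with variables in place of thetas. *)
have pX B : p B * 'X_i' = \sum_(j < n | (j < i')%N) q j B * 'X_j.
  apply/eqP; rewrite -subr_eq0; apply/eqP.
  move: B; apply: (free_eta_true
    (w := fun B => p B * 'X_i' - \sum_(j < n | (j < i')%N) q j B * 'X_j)).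
  under eq_bigr do rewrite rmorphB mulrBl /=.
  rewrite sumrB; apply/eqP; rewrite subr_eq0; apply/eqP.
  transitivity (f * (th i').[a%:MP]).
    by rewrite pE mulr_suml; apply: eq_bigr => B _; rewrite rmorphM /= msubstX mulrAC.
  rewrite fE; transitivity (\sum_(j < n | (j < i)%N)
    (\sum_B T a (q j B) * eta true a B) * (th j).[a%:MP]).
    by apply: eq_bigr => j ji; rewrite /= [g`_j]qE.
  under eq_bigr do rewrite mulr_suml.
  rewrite exchange_big; apply: eq_bigr => B _.
  rewrite raddf_sum mulr_suml; apply: eq_bigr => j _.
  by rewrite /= rmorphM /= msubstX mulrAC.
have [u uE] := fin_all_exists (fun B => regular_vars (pX B)).
exists [seq \sum_B T a (u B j) * eta true a B | j <- take i (enum 'I_n)]; split.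
- by rewrite st size_map size_take size_enum_ord im.
- by move=> x /mapP[j _ ->]; apply: hook_span_newton_alg; exists (u^~ j).
rewrite sumE pE; transitivity (\sum_(j < n | (j < i)%N)
    (\sum_B T a (u B j) * eta true a B) * (th j).[a%:MP]); last first.
  apply: eq_bigr => j ji; rewrite /= (nth_map i'); last by rewrite size_take size_enum_ord im.
  have -> : nth i' (take i (enum 'I_n)) j = j by rewrite nth_take // nth_ord_enum.
  by [].
under [RHS]eq_bigr do rewrite mulr_suml.
rewrite [RHS]exchange_big; apply: eq_bigr => B _.
rewrite {1}uE raddf_sum mulr_suml; apply: eq_bigr => j _.
by rewrite /= rmorphM /= msubstX mulrAC.
Qed.

End GoodParameter.
End Endgame.

(** * The finite set of exceptional parameters *)

Lemma generic_CohenMacaulay (F : fieldType) (r s : nat) :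
  [pchar F] =i pred0 -> (0 < r + s)%N ->
  exists2 c : {poly F}, c != 0 &
    forall a, c.[a] != 0 -> CohenMacaulay (@newton_alg F r s a).
Proof.
move=> charF rs0.
have /fin_all_exists2[th thA th0] := @theta_lift F r s charF.
have /fin_all_exists2[et etA et0] := @eta_lift F r s charF.
pose box := {ffun 'I_r -> 'I_s.+1}.
pose D1 := (\max_(B : box) eta_deg false B)%N.
pose D2 := (\max_i @theta_deg r s i)%N.
pose D3 := (\max_(B : box) msize (vander F r s ^+ 2 * eta0 F false B))%N.
pose D4 := (\max_(m < (r + s).+1) \max_(B : box) msize ((var_poly F r s)`_m * eta0 F false B))%N.
pose D5 := (\max_(B : box) eta_deg true B)%N.
pose D6 := #|{: box * 'I_(r + s)}|.
(* One degree large enough for all the finitely many expansions used at a good parameter; it does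
   not depend on a. *)
pose D := (D1 + D2 + D3 + D4 + (D6 + D5))%N.
have h1 (B : box) : (eta_deg false B <= D1)%N by apply: leq_bigmax.
have h2 i : (@theta_deg r s i <= D2)%N by apply: leq_bigmax.
have h3 (B : box) : (msize (vander F r s ^+ 2 * eta0 F false B) <= D3)%N.
  exact: (leq_bigmax (F := fun B : box => msize (vander F r s ^+ 2 * eta0 F false B))).
have h4 m (B : box) : (msize ((var_poly F r s)`_m * eta0 F false B) <= D4)%N.
  have [mn|nm] := ltnP m (r + s).+1; last first.
    by rewrite nth_default ?size_var_poly // mul0r msize0.
  apply: leq_trans (leq_bigmax (Ordinal mn)).
  exact: (leq_bigmax (F := fun B : box => msize ((var_poly F r s)`_m * eta0 F false B))).
have h5 (B : box) : (eta_deg true B <= D5)%N by apply: leq_bigmax.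
have [cF cF0 cFP] := generic_in_span charF thA th0 etA et0 false D.
have [cT cT0 cTP] := generic_in_span charF thA th0 etA et0 true D.
have nz (c : {poly F}) : c.[0] != 0 -> c != 0 by apply: contraNneq => ->; rewrite horner0.
(* The factor ['X] excludes a = 0, where the families are not known to lie in the algebra. *)
exists ('X * (cF * cT)) => [|a]; first by rewrite !mulf_neq0 ?polyX_eq0 ?nz.
rewrite !hornerM hornerX !mulf_eq0 !negb_or => /and3P[a0 aF aT].
apply: (@newton_alg_CohenMacaulay F r s charF th et thA th0 etA et0 a D) => //.
- by move=> d f dD; apply: cFP.
- by move=> d f dD; apply: cTP.
(* At a = 0 no degree bound arises: the exceptional polynomial of every degree is nonzero there. *)
- move=> d f; have [c c0 cP] := generic_in_span_at charF thA th0 etA et0 false d.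
  exact: (cP 0 c0).
- by move=> B; apply: leq_trans (h1 B) _; rewrite /D -!addnA leq_addr.
- move=> i B; apply: leq_trans (leq_add (h2 i) (h1 B)) _.
  by rewrite addnC /D -!addnA addnA leq_addr.
- move=> B; apply: leq_trans (h3 B) _; apply: leqW.
  by rewrite /D; clear -D1 D2 D3 D4 D5 D6; clearbody D1 D2 D3 D4 D5 D6; lia.
- by move=> m B; apply: leq_trans (h4 m B) _; apply: leqW; rewrite /D; clear -D1 D2 D3 D4 D5 D6;
    clearbody D1 D2 D3 D4 D5 D6; lia.
- move=> B; apply: leq_trans (leq_add (leqnn D6) (h5 B)) _.
  by rewrite /D leq_addl.
Qed.

Theorem theorem4p3 (r s : nat) (hr : (0 < r)%N) (hs : (0 < s)%N) :
  exists S : seq Cplx, forall a : Cplx, a \notin S -> CohenMacaulay (Lambda r s a).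
Proof.
have charC : [pchar Cplx] =i pred0 by exact: (Num.Theory.pchar_num (complex Rdefinitions.R)).
have rs0 : (0 < r + s)%N by rewrite addn_gt0 hr.
have [c c0 cP] := generic_CohenMacaulay charC rs0.
have [S cE] := closed_field_poly_normal (c : {poly complex Rdefinitions.R}).
(* [Lambda] and [newton_alg] are convertible; the exceptional values are the roots of [c]. *)
exists S => a aS; apply: cP; apply: contra aS => ra.
move: ra; rewrite /root cE hornerZ mulf_eq0 lead_coef_eq0.
by rewrite (negPf c0) -[X in _ || X]/(root _ a) root_prod_XsubC.
Qed.
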